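(* Let $\Omega\subset\mathbb{R}^n$ be open and bounded, $F\in C^0\big(\mathbb{R}\times\mathbb{R}^n\times\mathbb{S}(n)\big)$ and $f\in C^0(\overline{\Omega})$. Assume that for all $r,s\in\mathbb{R}$, $p\in\mathbb{R}^n$, $X,Y\in\mathbb{S}(n)$, $$X\le Y\ \Longrightarrow\ F(r,p,X)\le F(r,p,Y),$$ $$r\le s\ \Longrightarrow\ F(r,p,X)\ge F(s,p,X)+\gamma(s-r),$$ for some constant $\gamma>0$. Suppose that $u\in C^0(\overline{\Omega})$ is a viscosity solution of $F(u,Du,D^2u)\ge f$ on $\Omega$ and that $v\in C^0(\overline{\Omega})$ is a viscosity solution of $F(v,Dv,D^2v)\le f$ on $\Omega$. Then $$u\le v\ \text{ on }\partial\Omega\quad\Longrightarrow\quad u\le v\ \text{ on }\overline{\Omega}.$$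
   Context: $\mathbb{S}(n)$ is the space of real symmetric $n\times n$ matrices, ordered by: $X\le Y$ iff $Y-X$ is positive semidefinite; $X:z\otimes z=\sum_{i,j}X_{ij}z_iz_j$. For $u:\Omega\to\mathbb{R}$ and $x\in\Omega$, $\mathcal{J}^{2,+}u(x)$ is the set of all $(p,X)\in\mathbb{R}^n\times\mathbb{S}(n)$ such that $u(x+z)\le u(x)+p\cdot z+\frac12X:z\otimes z+o(|z|^2)$ as $z\to0$; $\mathcal{J}^{2,-}u(x)$ is defined in the same way with $\le$ replaced by $\ge$. $u$ is a viscosity solution of $F(u,Du,D^2u)\ge f$ on $\Omega$ if $F(u(x),p,X)\ge f(x)$ for all $x\in\Omega$ and all $(p,X)\in\mathcal{J}^{2,+}u(x)$. $v$ is a viscosity solution of $F(v,Dv,D^2v)\le f$ on $\Omega$ if $F(v(x),p,X)\le f(x)$ for all $x\in\Omega$ and all $(p,X)\in\mathcal{J}^{2,-}v(x)$. *)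

(* Defs.v *)
(* MathComp + MathComp-Analysis; R^n is 'rV[R]_n. *)
From HB Require Import structures.
From mathcomp Require Import all_boot all_order all_algebra.
From mathcomp Require Import all_classical all_reals all_analysis.
Set Implicit Arguments.
Unset Strict Implicit.
Unset Printing Implicit Defensive.
Import Order.TTheory GRing.Theory Num.Theory.
Import numFieldNormedType.Exports.
Local Open Scope classical_set_scope.
Local Open Scope ring_scope.

Definition symmx (R : realType) (n : nat) : set 'M[R]_n := [set X | X^T = X].
Arguments symmx {R} n.

(* The norm `|z| of the library on 'rV[R]_n is the sup norm; the squared
   Euclidean norm is edot z z. *)
Definition edot (R : realType) (n : nat) (p z : 'rV[R]_n) : R :=
  \sum_(i < n) p 0 i * z 0 i.

(* X : z (x) z *)
Definition qform (R : realType) (n : nat) (X : 'M[R]_n) (z : 'rV[R]_n) : R :=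
  \sum_(i < n) \sum_(j < n) X i j * z 0 i * z 0 j.

(* Only used for X, Y in symmx n. *)
Definition loewner_le (R : realType) (n : nat) (X Y : 'M[R]_n) : Prop :=
  forall z : 'rV[R]_n, 0 <= qform (Y - X) z.

(* Functions on Omega or on its closure are total functions on 'rV[R]_n; the
   guard Omega (x + z) makes the semijets depend only on the values on Omega. *)
Definition superjet (R : realType) (n : nat) (Omega : set 'rV[R]_n)
    (u : 'rV[R]_n -> R) (x : 'rV[R]_n) : set ('rV[R]_n * 'M[R]_n) :=
  [set pX | symmx n pX.2 /\
    exists2 o : 'rV[R]_n -> R,
      o =o_ (0 : 'rV[R]_n) (fun z => edot z z) &
      \forall z \near (0 : 'rV[R]_n), Omega (x + z) ->
        u (x + z) <= u x + edot pX.1 z + 2^-1 * qform pX.2 z + o z].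

Definition subjet (R : realType) (n : nat) (Omega : set 'rV[R]_n)
    (u : 'rV[R]_n -> R) (x : 'rV[R]_n) : set ('rV[R]_n * 'M[R]_n) :=
  [set pX | symmx n pX.2 /\
    exists2 o : 'rV[R]_n -> R,
      o =o_ (0 : 'rV[R]_n) (fun z => edot z z) &
      \forall z \near (0 : 'rV[R]_n), Omega (x + z) ->
        u (x + z) >= u x + edot pX.1 z + 2^-1 * qform pX.2 z + o z].

Definition viscosity_ge (R : realType) (n : nat) (Omega : set 'rV[R]_n)
    (F : R -> 'rV[R]_n -> 'M[R]_n -> R) (f u : 'rV[R]_n -> R) : Prop :=
  forall x, Omega x -> forall p X, superjet Omega u x (p, X) ->
    F (u x) p X >= f x.

Definition viscosity_le (R : realType) (n : nat) (Omega : set 'rV[R]_n)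
    (F : R -> 'rV[R]_n -> 'M[R]_n -> R) (f v : 'rV[R]_n -> R) : Prop :=
  forall x, Omega x -> forall p X, subjet Omega v x (p, X) ->
    F (v x) p X <= f x.

(* Main.v *)
Require Import Defs.
From HB Require Import structures.
From mathcomp Require Import all_boot all_order all_algebra.
From mathcomp Require Import all_classical all_reals all_analysis.
From mathcomp Require Import lra ring zify.
Set Implicit Arguments.
Unset Strict Implicit.
Unset Printing Implicit Defensive.
Import Order.TTheory GRing.Theory Num.Theory.
Import numFieldNormedType.Exports.
Local Open Scope classical_set_scope.
Local Open Scope ring_scope.

(** The argument is the classical one for viscosity solutions, with a
measure-free proof of its hard step.

Suppose u - v is positive somewhere, and put a penalty delta > 0 on the
distance of two points. Let
  a(x) = max_y (delta u(y) - |y|^2/2 + x.y),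
  b(x) = max_z (- delta v(z) - |z|^2/2 + x.z),
the maxima being over the closure of Omega. These are convex functions, up to
normalisation the sup-convolutions of u and -v. A quadratic touching a from
above at x must have as slope there the maximiser y, and it transports to a
quadratic touching delta u from above at y, the Hessian losing one identity
([supconv_jet]); likewise for b and v. At a maximum point xh of
a + b - |x|^2 the two maximisers y, z satisfy y + z = 2 xh. If a and b were
twice differentiable at xh, their Hessians X, Y would satisfy X + Y <= 2I,
that is X - I <= I - Y. The slopes (y - xh)/delta and (xh - z)/delta agree, so
ellipticity and properness would give gamma (u(y) - v(z)) <= f(z) - f(y), and
letting delta tend to 0 is a contradiction since y and z then have a common
limit in Omega ([penalized_comparison] and [theorem1]).

The hard step is that a and b can be treated as twice differentiable at points
near xh: [convex_sums_jets] provides fixed X, Y with X + Y <= 2I such that, for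
every eps > 0, quadratics of Hessian X + eps I and Y + eps I touch a and b from
above at points arbitrarily close to xh. This usually rests on the theorems of
Alexandrov and Jensen. Here it is proved by counting on a fine lattice.

- Jensen: tilt a + b - (1 + 1/m)|x|^2 by a linear function and maximise over
  the lattice. At a maximiser the second differences of the convex function
  a + b are pinched between 0 and those of a multiple of |x|^2, hence so are
  those of a and of b. Well separated slopes yield distinct maximisers
  ([contact_inj]), so the maximisers fill a fixed proportion of a lattice box.

- Alexandrov: let q_j be the second difference quotient of a at scale 2^j in a
  fixed direction. It is nonnegative, and q_(j+1) is an average of three values
  of q_j. The sum over the lattice of the bounded, strictly convex quantity
  1/(1 + q_j) therefore decreases with j up to boundary effects, and the total
  of its drops is bounded independently of the number of scales
  ([energy_decay]). With many scales, some scale has a small average drop, and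
  some maximiser lies where all drops are small, for all directions and
  neighbouring points in a prescribed finite set ([discrete_blowup]).

- Where the drops vanish, q is invariant under a step in its own direction.
  Rescaling around the good maximisers and passing to a limit along an
  ultrafilter gives functions on Z^n with this exact invariance, and these are
  quadratic polynomials ([quadratic_expansion], [quadratic_limit]). Their
  quadratic parts are X and Y.

- Back in R^n, a convex function below a quadratic polynomial on a
  lattice box is below it on the whole box up to a bounded error
  ([lattice_interpolation]), which eps|x|^2/2 beats at the boundary of a large
  box: an interior maximum then produces the touching quadratic
  ([approx_above_touching]). *)

(** * Second differences and their energy *)

Section SeqSums.
Context {R : realType} {T : choiceType}.
Implicit Types (s t : seq T) (F : T -> R).

Lemma sum_subseq_le s t F : uniq s -> {subset s <= t} ->
  (forall x, 0 <= F x) -> \sum_(x <- s) F x <= \sum_(x <- t) F x.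
Proof.
move=> us st F0.
rewrite (perm_big [seq x <- undup t | x \in s])/=; last first.
  apply: uniq_perm => //; first by rewrite filter_uniq// undup_uniq.
  move=> x; rewrite mem_filter mem_undup.
  by case: (boolP (x \in s)) => // /st ->.
rewrite big_filter (@le_trans _ _ (\sum_(x <- undup t) F x))//.
  rewrite [leRHS](bigID (fun x => x \in s))/= lerDl.
  by apply: sumr_ge0.
elim: t {st} => //= x t IH; case: ifP => xt; rewrite !big_cons.
  by rewrite (le_trans IH)// lerDr.
by rewrite lerD2l.
Qed.

Lemma seq_argmax s F : s != [::] ->
  exists2 x, x \in s & forall y, y \in s -> F y <= F x.
Proof.
elim: s => // x s IH _.
have [->|/IH[y ys ymax]] := eqVneq s [::].
  by exists x; rewrite ?mem_head// => y; rewrite inE => /eqP ->.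
have [xy|yx] := leP (F x) (F y).
  exists y; first by rewrite inE ys orbT.
  by move=> z; rewrite inE => /predU1P[->|/ymax].
exists x; first exact: mem_head.
move=> z; rewrite inE => /predU1P[->//|/ymax zy].
by rewrite (le_trans zy)// ltW.
Qed.

End SeqSums.

Section SecondDifference.
Context {R : realType} {V : zmodType}.
Implicit Types (f g : V -> R) (d x : V).

Definition diff2 f d x : R := f (x + d) + f (x - d) - 2 * f x.

Lemma diff2D f g d x : diff2 (fun x => f x + g x) d x = diff2 f d x + diff2 g d x.
Proof. rewrite /diff2; ring. Qed.

(** A second difference at twice the scale is four times an average of three
second differences at the original scale; the whole multiscale argument rests
on this identity. *)
Lemma diff2_double f d x :
  diff2 f (d *+ 2) x = diff2 f d (x + d) + 2 * diff2 f d x + diff2 f d (x - d).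
Proof. by rewrite /diff2 mulr2n addrK opprD subrK !addrA; ring. Qed.

(** A bounded, strictly convex and decreasing function of the second difference
quotient at scale 2^j: boundedness makes it summable whatever the size of the
quotient, strict convexity makes [defect] detect any variation of it. *)
Definition flatness f j d x : R := (1 + diff2 f (d *+ 2 ^ j) x / 4 ^+ j)^-1.

Definition defect f j d x : R :=
  4^-1 * flatness f j d (x + d *+ 2 ^ j) + 2^-1 * flatness f j d x +
  4^-1 * flatness f j d (x - d *+ 2 ^ j) - flatness f j.+1 d x.

End SecondDifference.

(** Exact Jensen defect of q |-> 1/(1 + q) for the weights 1/4, 1/2, 1/4. As a
sum of weighted squares it shows both the sign of the defect and that the
defect vanishes only when the three values coincide. *)
Lemma inv1D_jensen {R : realType} (p q r : R) : 0 <= p -> 0 <= q -> 0 <= r ->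
  let m := (p + 2 * q + r) / 4 in
  4^-1 * (1 + p)^-1 + 2^-1 * (1 + q)^-1 + 4^-1 * (1 + r)^-1 - (1 + m)^-1 =
  (1 + m)^-2 * (4^-1 * ((p - m) ^+ 2 / (1 + p)) + 2^-1 * ((q - m) ^+ 2 / (1 + q)) +
    4^-1 * ((r - m) ^+ 2 / (1 + r))).
Proof. 
move=> p0 q0 r0 m.
have tangent x : 0 <= x ->
    (1 + x)^-1 = (1 + m)^-1 - (1 + m)^-2 * (x - m) + (1 + m)^-2 * ((x - m) ^+ 2 / (1 + x)).
  move=> x0; have ? : 1 + x != 0 by rewrite gt_eqF//; lra.
  have ? : 1 + m != 0 by rewrite gt_eqF// /m; lra.
  by field; apply/andP.
rewrite (tangent p)// (tangent q)// (tangent r)//.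
have mid : 4^-1 * (p - m) + 2^-1 * (q - m) + 4^-1 * (r - m) = 0 by rewrite /m; field.
apply/eqP; rewrite -subr_eq0; apply/eqP.
by rewrite -[RHS](mulr0 (- (1 + m)^-2)) -mid; field; rewrite gt_eqF// /m; lra.
Qed.

Section Energy.
Context {R : realType} {V : zmodType}.
Implicit Types (f : V -> R) (d x : V).

Definition midconvex f := forall d x, 0 <= diff2 f d x.

Lemma flatness_ge0 f j d x : midconvex f -> 0 <= flatness f j d x.
Proof. by move=> cf; rewrite invr_ge0 addr_ge0// mulr_ge0// invr_ge0 exprn_ge0. Qed.

Lemma flatness_le1 f j d x : midconvex f -> flatness f j d x <= 1.
Proof.
by move=> cf; rewrite invf_le1 ?lerDl ?ltr_wpDr// mulr_ge0// invr_ge0 exprn_ge0.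
Qed.

(** After division by the square of the scale, the quotient at scale j.+1 is the
1/4, 1/2, 1/4 average of three quotients at scale j. *)
Lemma flatnessS f j d x (v := d *+ 2 ^ j) : flatness f j.+1 d x =
  (1 + (diff2 f v (x + v) / 4 ^+ j + 2 * (diff2 f v x / 4 ^+ j) +
        diff2 f v (x - v) / 4 ^+ j) / 4)^-1.
Proof.
rewrite /flatness expnSr mulrnA diff2_double -/v exprS; congr (_ + _)^-1.
by field; rewrite expf_neq0.
Qed.

Lemma defect_ge0 f j d x : midconvex f -> 0 <= defect f j d x.
Proof.
move=> cf; have q0 y : 0 <= diff2 f (d *+ 2 ^ j) y / 4 ^+ j.
  by rewrite mulr_ge0// invr_ge0 exprn_ge0.
rewrite /defect flatnessS /flatness inv1D_jensen//.
rewrite mulr_ge0 ?invr_ge0 ?sqr_ge0//.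
have sq_ge0 (a b : R) : 0 <= b -> 0 <= a ^+ 2 / (1 + b).
  by move=> b0; rewrite mulr_ge0 ?sqr_ge0// invr_ge0 addr_ge0.
by rewrite !addr_ge0// mulr_ge0// ?invr_ge0// sq_ge0.
Qed.

End Energy.

(** * Energy decay on lattice boxes *)

(** The lattice points of sup norm at most N, as a sequence, so that a box can be
shifted and compared with another by inclusion. *)
Definition box (n N : nat) : seq 'rV[int]_n :=
  [seq (\row_i ((t i)%:Z - N%:Z)) | t : {ffun 'I_n -> 'I_N.*2.+1}].

Section Box.
Context {n : nat}.
Implicit Types (N : nat) (k v : 'rV[int]_n).

Lemma box_uniq N : uniq (box n N).
Proof.
rewrite map_inj_uniq ?enum_uniq// => s t /rowP st; apply/ffunP => i.
by have := st i; rewrite !mxE => /addIr[] /val_inj.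
Qed.

Lemma size_box N : size (box n N) = (N.*2.+1 ^ n)%N.
Proof. by rewrite size_map -cardT card_ffun !card_ord. Qed.

Lemma mem_boxP N k : reflect (forall i, (absz (k 0%R i) <= N)%N) (k \in box n N).
Proof.
apply: (iffP mapP) => [[t _ ->] i|kN].
  by rewrite mxE; move: (nat_of_ord (t i)) (ltn_ord (t i)) => z; lia.
have lt i : (absz (k 0%R i + N%:Z)%R < N.*2.+1)%N.
  by have := kN i; lia.
exists [ffun i => Ordinal (lt i)]; first by rewrite mem_enum.
by apply/rowP => i; rewrite !mxE ffunE /=; have := kN i; lia.
Qed.

Lemma box_sub N N' : (N <= N')%N -> {subset box n N <= box n N'}.
Proof. by move=> NN k /mem_boxP kN; apply/mem_boxP => i; rewrite (leq_trans (kN i)). Qed.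

Lemma box_add N N' k v : k \in box n N -> v \in box n N' -> k + v \in box n (N + N').
Proof.
move=> /mem_boxP kN /mem_boxP vN; apply/mem_boxP => i; rewrite mxE.
by move: (k 0 i) (v 0 i) (kN i) (vN i) => a b; lia.
Qed.

Lemma box_opp N k : k \in box n N -> - k \in box n N.
Proof. by move=> /mem_boxP kN; apply/mem_boxP => i; rewrite mxE abszN. Qed.

Lemma box_muln N k a : k \in box n N -> k *+ a \in box n (N * a).
Proof.
move=> /mem_boxP kN; apply/mem_boxP => i.
by rewrite mulmxnE -mulr_natr abszM natz absz_nat leq_mul.
Qed.

Lemma box0 N : 0 \in box n N.
Proof. by apply/mem_boxP => i; rewrite mxE. Qed.

Lemma sum_box_shift {R : realType} N N' v (F : 'rV[int]_n -> R) :
  v \in box n N' -> (forall k, 0 <= F k) ->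
  \sum_(k <- box n N) F (k + v) <= \sum_(k <- box n (N + N')) F k.
Proof.
move=> vN F0; rewrite -(big_map (fun k => k + v) xpredT F).
apply: sum_subseq_le => //; first by rewrite map_inj_uniq ?box_uniq//; exact: addIr.
by move=> _ /mapP[k kN ->]; exact: box_add.
Qed.

End Box.

Section EnergyDecay.
Context {R : realType} {n : nat}.
Variables (f : 'rV[int]_n -> R) (cf : midconvex f) (m : nat) (d : 'rV[int]_n).
Hypothesis dm : d \in box n m.

(** The energy, i.e. the sum of the flatness over a box, cannot increase from one
scale to the next; the box shrinks by the length of the step to absorb the
boundary terms of the shifted sums. *)
Lemma energy_step N j :
  \sum_(k <- box n N) flatness f j.+1 d k + \sum_(k <- box n N) defect f j d k
  <= \sum_(k <- box n (N + m * 2 ^ j)) flatness f j d k.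
Proof.
set v := d *+ 2 ^ j.
rewrite -big_split /=.
under eq_bigr do rewrite addrC subrK.
rewrite 2!big_split/= -!mulr_sumr.
have F0 k : 0 <= flatness f j d k by exact: flatness_ge0.
have vN : v \in box n (m * 2 ^ j) by exact: box_muln.
have h1 := @sum_box_shift _ R N _ _ _ vN F0.
have h2 := sum_subseq_le (box_uniq N) (box_sub (leq_addr (m * 2 ^ j) N)) F0.
have h3 := @sum_box_shift _ R N _ _ _ (box_opp vN) F0.
by lra.
Qed.

(** The bound does not grow with M apart from the enlargement of the box, hence
among many scales one must have a small total defect. *)
Lemma energy_decay N M :
  \sum_(j < M) \sum_(k <- box n N) defect f j d k <= (size (box n (N + m * 2 ^ M)))%:R.
Proof.
suff H N' : \sum_(j < M) \sum_(k <- box n N') defect f j d k +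
    \sum_(k <- box n N') flatness f M d k <= (size (box n (N' + m * 2 ^ M)))%:R.
  by apply: le_trans (H N); rewrite lerDl sumr_ge0// => k _; exact: flatness_ge0.
elim: M N' => [|M IH] N'.
  rewrite big_ord0 add0r expn0 muln1 -sum1_size natr_sum.
  apply: (@le_trans _ _ (\sum_(k <- box n N') 1)).
    by apply: ler_sum => k _; exact: flatness_le1.
  by apply: sum_subseq_le; rewrite ?box_uniq//; apply: box_sub; exact: leq_addr.
rewrite big_ord_recr/= -addrA [X in _ + X]addrC.
apply: (@le_trans _ _ (\sum_(j < M) \sum_(k <- box n (N' + m * 2 ^ M)) defect f j d k +
   \sum_(k <- box n (N' + m * 2 ^ M)) flatness f M d k)).
  apply: lerD; last exact: energy_step.
  apply: ler_sum => j _; apply: sum_subseq_le; first exact: box_uniq.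
    by apply: box_sub; exact: leq_addr.
  by move=> k; exact: defect_ge0.
by rewrite (le_trans (IH _))// -addnA -mulnDr addnn expnS mul2n.
Qed.

End EnergyDecay.

(** * Counting contact points *)

Section Edot.
Context {R : realType} {n : nat}.
Implicit Types (x y z : 'rV[R]_n) (c : R).

Lemma edotC x y : edot x y = edot y x.
Proof. by apply: eq_bigr => i _; rewrite mulrC. Qed.

Lemma edotDr x y z : edot x (y + z) = edot x y + edot x z.
Proof. by rewrite -big_split; apply: eq_bigr => i _; rewrite mxE mulrDr. Qed.

Lemma edotDl x y z : edot (y + z) x = edot y x + edot z x.
Proof. by rewrite edotC edotDr !(edotC x). Qed.

Lemma edotZr c x y : edot x (c *: y) = c * edot x y.
Proof. by rewrite mulr_sumr; apply: eq_bigr => i _; rewrite mxE mulrCA. Qed.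

Lemma edotZl c x y : edot (c *: y) x = c * edot y x.
Proof. by rewrite edotC edotZr edotC. Qed.

Lemma edotNr x y : edot x (- y) = - edot x y.
Proof. by rewrite -scaleN1r edotZr mulN1r. Qed.

Lemma edotNl x y : edot (- y) x = - edot y x.
Proof. by rewrite edotC edotNr edotC. Qed.

Lemma edot0r x : edot x 0 = 0.
Proof. by rewrite -(scale0r 0) edotZr mul0r. Qed.

Lemma edot0l x : edot 0 x = 0.
Proof. by rewrite edotC edot0r. Qed.

Lemma edot_ge0 x : 0 <= edot x x.
Proof. by apply: sumr_ge0 => i _; rewrite -expr2 sqr_ge0. Qed.

Lemma edot_ge_sqr x i : x 0 i ^+ 2 <= edot x x.
Proof.
rewrite /edot (bigD1 i)//= expr2 lerDl.
by apply: sumr_ge0 => j _; rewrite -expr2 sqr_ge0.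
Qed.

Lemma edot_eq0 x : edot x x = 0 -> x = 0.
Proof.
move=> x0; apply/rowP => i; rewrite mxE; apply/eqP; rewrite -sqrf_eq0 eq_le sqr_ge0 andbT.
by rewrite -x0 edot_ge_sqr.
Qed.

End Edot.

Definition rowr (R : realType) (n : nat) (k : 'rV[int]_n) : 'rV[R]_n := map_mx intr k.
Arguments rowr R {n} k.

Section Rowr.
Context {R : realType} {n : nat}.
Implicit Types k v : 'rV[int]_n.

Lemma rowrD k v : rowr R (k + v) = rowr R k + rowr R v.
Proof. exact: map_mxD. Qed.

Lemma rowrN k : rowr R (- k) = - rowr R k.
Proof. exact: map_mxN. Qed.

Lemma rowrMn k a : rowr R (k *+ a) = a%:R *: rowr R k.
Proof. by apply/rowP => i; rewrite !mxE mulmxnE rmorphMn /= mulr_natl. Qed.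

Lemma rowr0 : rowr R (0 : 'rV_n) = 0.
Proof. exact: map_mx0. Qed.

End Rowr.

Section Contact.
Context {R : realType} {n : nat}.
Variable w : 'rV[int]_n -> R.
Variable m : nat.
Hypothesis m_gt0 : (0 < m)%N.
Implicit Types (p k v : 'rV[int]_n) (N P : nat).

(** The coefficient 1 + 1/m makes the maximum of the untilted function strict at
0. The factor 5 exceeds 2 (1 + 1/m) <= 4, the length of the interval of slopes
that one lattice point can serve; this is what [contact_inj] needs. *)
Definition tilted p k : R :=
  w k - (1 + m%:R^-1) * edot (rowr R k) (rowr R k) - 5 * edot (rowr R p) (rowr R k).

Definition contact N p k := k \in box n N /\
  forall k', k' \in box n N -> tilted p k' <= tilted p k.

Lemma contact_exists N p : exists k, contact N p k.
Proof.
have : box n N != [::] by apply: contraTneq (box0 (n := n) N) => ->.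
by move=> /(seq_argmax (tilted p))[k kN kmax]; exists k.
Qed.

(** Comparison with the value at 0: the surplus |k|^2/m must be paid by the tilt,
which is at most 5 n P |k|. *)
Lemma contact_box N P p k : w 0 = 0 ->
  (forall k, w k <= edot (rowr R k) (rowr R k)) ->
  p \in box n P -> contact N p k -> k \in box n (5 * n * m * P).
Proof.
move=> w0 wle /mem_boxP pP [_ /(_ 0 (box0 N))].
rewrite /tilted rowr0 !edot0r w0 => kmax.
pose K : nat := \max_(i < n) absz (k 0%R i).
have kK i : (absz (k 0%R i) <= K)%N by exact: (leq_bigmax i).
suff KP : (K <= 5 * n * m * P)%N by apply/mem_boxP => i; rewrite (leq_trans (kK i)).
have [->//|K0] := posnP K.
have [|i0 ki0] := @bigop.eq_bigmax _ (fun i : 'I_n => absz (k 0%R i)).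
  by rewrite card_ord lt0n; apply: contraTneq K0 => n0; rewrite /K big1// => i; have := ltn_ord i; rewrite {2}n0.
have K2 : K%:R ^+ 2 <= edot (rowr R k) (rowr R k).
  apply: le_trans (edot_ge_sqr _ i0); rewrite mxE /K ki0 -[(k 0 i0)%:~R ^+ 2]real_normK ?num_real//.
  by rewrite -intr_norm -abszE.
have pk : - edot (rowr R p) (rowr R k) <= (n * P * K)%:R.
  rewrite -mulnA mulnC -[X in (_ * X)%N]card_ord natrM mulr_natr -sumr_const.
  rewrite -sumrN; apply: ler_sum => i _; rewrite !mxE -rmorphM -rmorphN /=.
  rewrite -[(P * K)%:R]/((P * K)%N%:~R) ler_int.
  by move: (p 0 i) (k 0 i) (pP i) (kK i) => a b aP bK; nia.
have mK : m%:R^-1 * K%:R ^+ 2 <= 5 * (n * P * K)%:R :> R.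
  have := wle k; have : m%:R^-1 * K%:R ^+ 2 <= m%:R^-1 * edot (rowr R k) (rowr R k).
    by rewrite ler_wpM2l// invr_ge0.
  lra.
have : (K * K <= 5 * n * m * P * K)%N.
  move: mK; rewrite mulrC ler_pdivrMr ?ltr0n// -natrX -!natrM ler_nat.
  by lia.
by rewrite leq_pmul2r.
Qed.

Lemma contact_diff2 N p k v : contact N p k -> k + v \in box n N -> k - v \in box n N ->
  diff2 w v k <= 2 * (1 + m%:R^-1) * edot (rowr R v) (rowr R v).
Proof.
move=> [_ kmax] /kmax + /kmax; rewrite /tilted rowrD rowrD rowrN.
rewrite !(edotDl, edotDr, edotNl, edotNr) (edotC (rowr R v) (rowr R k)) /diff2.
lra.
Qed.

(** Discrete counterpart of the Lipschitz bound on slopes over the contact set: at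
a contact point each coordinate of the slope lies between two consecutive
difference quotients, whose gap is controlled because w is midconvex. Distinct
integer slopes thus have distinct contact points. *)
Lemma contact_inj N N0 p p' k : midconvex w -> k \in box n N0 -> (N0 < N)%N ->
  contact N p k -> contact N p' k -> p = p'.
Proof.
move=> cw kN0 N0N.
have m1 : m%:R^-1 <= 1 :> R by rewrite invf_le1 ?ltr0n// ler1n.
suff H p1 p2 i : contact N p1 k -> contact N p2 k -> p2 0 i <= p1 0 i.
  by move=> c c'; apply/rowP => i; apply/eqP; rewrite eq_le !H.
pose v := delta_mx 0 i : 'rV[int]_n.
have vb : v \in box n 1 by apply/mem_boxP => j; rewrite mxE; case: (_ && _).
have kv : k + v \in box n N.
  by apply: (@box_sub _ (N0 + 1)); [rewrite addn1|exact: box_add].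
have kw : k - v \in box n N.
  by apply: (@box_sub _ (N0 + 1)); [rewrite addn1|exact/box_add/box_opp].
move=> [_ /(_ _ kv) c1] [_ /(_ _ kw) c2].
have dotv q : edot (rowr R q) (rowr R v) = (q 0 i)%:~R.
  rewrite /edot (bigD1 i)//= big1 => [|j ji]; rewrite !mxE ?eqxx ?mulr1 ?addr0//.
  by rewrite (negbTE ji) mulr0.
move: c1 c2; rewrite /tilted rowrD rowrD rowrN.
rewrite !(edotDl, edotDr, edotNl, edotNr) !(edotC (rowr R v) (rowr R k)) !dotv mxE !eqxx /=.
have := cw v k; rewrite /diff2 => h1 h2 h3.
have : (p2 0 i)%:~R - (p1 0 i)%:~R < 1 :> R by lra.
by rewrite -rmorphB -[1]/(1%:~R) ltr_int; lia.
Qed.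

End Contact.

(** * A good contact point at a good scale *)

Lemma midconvexD {R : realType} {V : zmodType} (f g : V -> R) :
  midconvex f -> midconvex g -> midconvex (fun x => f x + g x).
Proof. by move=> cf cg d x; rewrite diff2D addr_ge0. Qed.

Lemma leq_expl (a b e : nat) : (a <= b)%N -> (a ^ e <= b ^ e)%N.
Proof. by case: e => // e; rewrite leq_exp2r. Qed.

Section Pigeonhole.
Context {R : realType} {n : nat}.
Implicit Types (A B f : 'rV[int]_n -> R) (k d y e : 'rV[int]_n).

(** Shifting by y at scale 2^j only enlarges the box, so the bound of
[energy_decay] holds for the defects observed around the points of K. *)
Lemma sum_defect_shift f m M N P (K : seq 'rV[int]_n) d y : midconvex f ->
  uniq K -> {subset K <= box n N} -> d \in box n m -> y \in box n m ->
  (m * 2 ^ M <= P)%N ->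
  \sum_(j < M) \sum_(k <- K) defect f j d (k + y *+ 2 ^ j) <=
    (size (box n (N + P + P)))%:R.
Proof.
move=> cf uK KN dm ym MP.
have dge0 j k : 0 <= defect f j d k by exact: defect_ge0.
apply: (@le_trans _ _ (size (box n (N + P + m * 2 ^ M)))%:R); last first.
  by rewrite !size_box ler_nat leq_expl//; lia.
apply: le_trans (energy_decay cf dm _ _); apply: ler_sum => j _.
apply: (@le_trans _ _ (\sum_(k <- box n N) defect f j d (k + y *+ 2 ^ j))).
  exact: sum_subseq_le.
apply: sum_box_shift => //; apply: (box_sub (N := m * 2 ^ j)); last exact: box_muln.
by rewrite (leq_trans _ MP)// leq_mul// leq_exp2l// ltnW.
Qed.

(** Discrete substitute for the theorems of Jensen and Alexandrov. The
contact points number at least a fixed fraction of a box, and the sum over all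
scales of all defects around them is at most a constant times the size of the
box. With enough scales some contact point and some scale have all their
defects below 1/m. The number N depends on m and n only, which allows the mesh
of the lattice to be chosen afterwards. *)
Lemma discrete_blowup m : (0 < m)%N -> exists N, (0 < N)%N /\ forall A B,
  midconvex A -> midconvex B -> A 0 + B 0 = 0 ->
  (forall k, A k + B k <= edot (rowr R k) (rowr R k)) ->
  exists k j, [/\ k \in box n N, (m * 2 ^ j <= N)%N,
    forall e, e \in box n m -> diff2 A (e *+ 2 ^ j) k + diff2 B (e *+ 2 ^ j) k <=
      2 * (1 + m%:R^-1) * (4 ^+ j * edot (rowr R e) (rowr R e)) &
    forall d y, d \in box n m -> y \in box n m ->
      defect A j d (k + y *+ 2 ^ j) <= m%:R^-1 /\
      defect B j d (k + y *+ 2 ^ j) <= m%:R^-1].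
Proof.
move=> m_gt0.
(* The side 2 N + 1 of the largest box is at most 14 (n + 1) m times the side
   2 P + 1 of the box of slopes, and M is what makes the average over scales and
   contact points of the sum T of the relevant defects at most 1/m. *)
pose S := size (box n m).
pose C := (14 * n.+1 * m)%N.
pose M := (2 * S ^ 2 * C ^ n * m).+1.
pose P := (m * 2 ^ M)%N.
pose N0 := (5 * n.+1 * m * P)%N.
pose N := (N0 + P + P)%N.
have P_gt0 : (0 < P)%N by rewrite muln_gt0 m_gt0 expn_gt0.
have scaleP j : (j <= M)%N -> (m * 2 ^ j <= P)%N by move=> jM; rewrite leq_mul// leq_exp2l.
exists N; split; first by rewrite /N; lia.
move=> A B cA cB AB0 ABle.
set w := fun k => A k + B k in ABle.
have cw : midconvex w by exact: midconvexD.
have [kp kpE] := choice (contact_exists w m N).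
have kpN0 p : p \in box n P -> kp p \in box n N0.
  move=> pP; apply: box_sub (contact_box m_gt0 AB0 ABle pP (kpE p)).
  by rewrite /N0 !leq_mul.
pose K := [seq kp p | p <- box n P].
have KN0 : {subset K <= box n N0} by move=> _ /mapP[p pP ->]; exact: kpN0.
have uK : uniq K.
  rewrite map_inj_in_uniq ?box_uniq// => p p' pP p'P pp'.
  apply: (contact_inj m_gt0 cw (kpN0 _ pP) _ (kpE p)); first by rewrite /N; lia.
  by rewrite pp'.
have sK : size K = (P.*2.+1 ^ n)%N by rewrite size_map size_box.
pose T j k : R := \sum_(d <- box n m) \sum_(y <- box n m)
   (defect A j d (k + y *+ 2 ^ j) + defect B j d (k + y *+ 2 ^ j)).
have Tle : \sum_(j < M) \sum_(k <- K) T j k <= (2 * S ^ 2 * size (box n N))%:R.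
  rewrite /T; under eq_bigr do rewrite exchange_big/=.
  rewrite exchange_big/=.
  apply: (@le_trans _ _ (\sum_(d <- box n m) \sum_(y <- box n m) (2 * size (box n N))%:R)).
    rewrite big_seq [leRHS]big_seq; apply: ler_sum => d dm.
    under eq_bigr do rewrite exchange_big/=.
    rewrite exchange_big/= big_seq [leRHS]big_seq; apply: ler_sum => y ym.
    under eq_bigr do rewrite big_split/=.
    rewrite big_split/= natrM mulr_natl mulr2n.
    by apply: lerD; exact: sum_defect_shift KN0 dm ym _.
  by rewrite !big_const_seq !iter_addr_0 !count_predT -/S -!mulrnA -mulnA mulnn mulnAC mulnA.
have defect0 f j d x : midconvex f -> 0 <= defect f j d x by exact: defect_ge0.
have [j [k [jM kK Tjk]]] : exists j k, [/\ (j < M)%N, k \in K & T j k <= m%:R^-1].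
  apply: contrapT => nT.
  have : \sum_(j < M) \sum_(k <- K) (m%:R^-1 : R) <= \sum_(j < M) \sum_(k <- K) T j k.
    apply: ler_sum => j _; rewrite big_seq [leRHS]big_seq; apply: ler_sum => k kK.
    by rewrite leNgt; apply/negP => /ltW Tjk; apply: nT; exists j, k.
  rewrite sumr_const card_ord big_const_seq iter_addr_0 count_predT => MK.
  have := le_trans MK Tle.
  rewrite -mulrnA -[leLHS]mulr_natr [leLHS]mulrC ler_pdivrMr ?ltr0n// -natrM ler_nat.
  have SC : (size (box n N) <= C ^ n * size K)%N.
    rewrite sK size_box -expnMn; apply: leq_expl.
    by rewrite /C /N /N0; nia.
  have K_gt0 : (0 < size K)%N by rewrite sK expn_gt0.
  apply/negP; rewrite -ltnNge.
  apply: (@leq_ltn_trans (2 * S ^ 2 * (C ^ n * size K) * m)); first by rewrite !leq_mul.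
  by rewrite mulnA [ltnLHS]mulnAC [ltnRHS]mulnC ltn_pmul2r.
have /mapP[p pP kE] := kK.
have jP := scaleP _ (ltnW jM).
exists k, j; split.
- by apply: box_sub (KN0 _ kK); rewrite /N -addnA leq_addr.
- by rewrite (leq_trans jP)// leq_addl.
- move=> e em; rewrite -diff2D.
  have eP : e *+ 2 ^ j \in box n P by apply: box_sub jP _ _; exact: box_muln.
  have NN : (N0 + P <= N)%N by exact: leq_addr.
  have := @contact_diff2 _ _ w m N p k (e *+ 2 ^ j).
  rewrite kE => /(_ (kpE p)); rewrite -kE => /(_ _ _)/le_trans; apply.
  + exact/(box_sub NN)/box_add/eP/KN0.
  + exact/(box_sub NN)/box_add/box_opp/eP/KN0.
  + rewrite rowrMn edotZl edotZr natrX mulrA -exprMn -natrM.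
    by rewrite -[(2 * 2)%:R]/(4%:R).
- move=> d y dm ym.
  have term_le (F : 'rV[int]_n -> R) z s : (forall z, 0 <= F z) -> z \in s ->
      F z <= \sum_(x <- s) F x.
    by move=> F0 zs; rewrite (big_rem z)//= lerDl sumr_ge0.
  have Tdy : defect A j d (k + y *+ 2 ^ j) + defect B j d (k + y *+ 2 ^ j) <= m%:R^-1.
    apply: le_trans Tjk.
    apply: le_trans (term_le (fun d => \sum_(y <- box n m) _) _ _ _ dm); last first.
      by move=> z; apply: sumr_ge0 => ? _; rewrite addr_ge0 ?defect0.
    by apply: (term_le (fun y => _ + _)) => // z; rewrite addr_ge0 ?defect0.
  by split; apply: le_trans Tdy; rewrite ?lerDl ?lerDr defect0.
Qed.

End Pigeonhole.

(** * Functions on the lattice with vanishing third differences *)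

Section ThirdDifferences.
Context {R : realType} {V : zmodType}.
Variable A : V -> R.
Implicit Types (d e f y : V).

(** Write u and v for the difference operators in the directions d and e. The
hypothesis says that third powers of difference operators annihilate A. From
the directions d, e and d + e one gets u^2 v^2 = 0 and u^2 v + u v^2 = 0; with
the direction 2d + e one also gets 2 u^2 v + u v^2 = 0, hence u^2 v = 0. The
grid of values below contains just the instances used. *)
Lemma diff2_invariant : (forall d y, diff2 A d (y + d) = diff2 A d y) ->
  forall d e y, diff2 A d (y + e) = diff2 A d y.
Proof.
move=> H d e y; rewrite -(subrK d y).
move: {y}(y - d) => y.
pose F i j := A (y + d *+ i + e *+ j).
have T a b i j : F (i + a + a + a)%N (j + b + b + b)%N - 3 * F (i + a + a)%N (j + b + b)%N +
    3 * F (i + a)%N (j + b)%N - F i j = 0.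
  have := H (d *+ a + e *+ b) (y + d *+ (i + a) + e *+ (j + b)).
  have step i' j' : y + d *+ i' + e *+ j' + (d *+ a + e *+ b) =
      y + d *+ (i' + a) + e *+ (j' + b).
    by rewrite !mulrnDr addrACA !addrA.
  have back i' j' : y + d *+ (i' + a) + e *+ (j' + b) - (d *+ a + e *+ b) =
      y + d *+ i' + e *+ j' by rewrite -step addrK.
  rewrite /diff2 !step !back.
  by rewrite /F; lra.
have -> : diff2 A d (y + d + e) = F 2 1 + F 0 1 - 2 * F 1 1.
  by rewrite /diff2 /F !mulr1n mulr0n addr0 mulr2n (addrAC _ e d) addrA (addrAC _ e (- d)) addrK.
have -> : diff2 A d (y + d) = F 2 0 + F 0 0 - 2 * F 1 0.
  by rewrite /diff2 /F !mulr1n !mulr0n !addr0 mulr2n addrA addrK.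
have s0 := T 1%N 1%N 0%N 0%N; have s1 := T 1%N 1%N 1%N 0%N; have w0 := T 2 1%N 0%N 0%N.
have u00 := T 1%N 0%N 0%N 0%N; have u01 := T 1%N 0%N 0%N 1%N.
have u02 := T 1%N 0%N 0%N 2; have u03 := T 1%N 0%N 0%N 3.
have u10 := T 1%N 0%N 1%N 0%N; have u11 := T 1%N 0%N 1%N 1%N.
have u12 := T 1%N 0%N 1%N 2; have u13 := T 1%N 0%N 1%N 3.
have u20 := T 1%N 0%N 2 0%N; have u21 := T 1%N 0%N 2 1%N.
have u22 := T 1%N 0%N 2 2; have u23 := T 1%N 0%N 2 3.
have u30 := T 1%N 0%N 3 0%N; have u31 := T 1%N 0%N 3 1%N.
have u32 := T 1%N 0%N 3 2; have u33 := T 1%N 0%N 3 3.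
have v0 := T 0%N 1%N 0%N 0%N; have v1 := T 0%N 1%N 1%N 0%N; have v2 := T 0%N 1%N 2 0%N.
rewrite /= in s0 s1 w0 u00 u01 u02 u03 u10 u11 u12 u13 u20 u21 u22 u23 u30 u31 u32 u33 v0 v1 v2.
lra.
Qed.

(** Polarisation of the previous invariance: with u, v, t the difference operators
in the directions d, e, f, the operator of direction d + e is u + v + uv, and
(u + v + uv)^2 t = 2 uvt as soon as u^2 t = v^2 t = 0. *)
Lemma mixed_third_eq0 : (forall d e y, diff2 A d (y + e) = diff2 A d y) ->
  forall d e f, A (d + e + f) - A (d + e) - A (d + f) - A (e + f) +
    A d + A e + A f - A 0 = 0.
Proof.
move=> H d e f.
pose F i j k := A (d *+ i + e *+ j + f *+ k).
have T a b i j : F (i + a + a)%N (j + b + b)%N 1%N - 2 * F (i + a)%N (j + b)%N 1%N + F i j 1%N =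
    F (i + a + a)%N (j + b + b)%N 0%N - 2 * F (i + a)%N (j + b)%N 0%N + F i j 0%N.
  have := H (d *+ a + e *+ b) f (d *+ (i + a) + e *+ (j + b)).
  have step i' j' : d *+ i' + e *+ j' + (d *+ a + e *+ b) =
      d *+ (i' + a) + e *+ (j' + b) by rewrite !mulrnDr addrACA.
  have back i' j' : d *+ (i' + a) + e *+ (j' + b) - (d *+ a + e *+ b) =
      d *+ i' + e *+ j' by rewrite -step addrK.
  rewrite /diff2 !(addrAC _ f) !step !back /F !mulr1n !mulr0n !addr0; lra.
have s := T 1%N 1%N 0%N 0%N.
have u0 := T 1%N 0%N 0%N 0%N; have u1 := T 1%N 0%N 0%N 1%N; have u2 := T 1%N 0%N 0%N 2.
have v0 := T 0%N 1%N 0%N 0%N; have v1 := T 0%N 1%N 1%N 0%N; have v2 := T 0%N 1%N 2 0%N.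
rewrite /= in s u0 u1 u2 v0 v1 v2.
suff : F 1%N 1%N 1%N - F 1%N 1%N 0%N - F 1%N 0%N 1%N - F 0%N 1%N 1%N + F 1%N 0%N 0%N +
    F 0%N 1%N 0%N + F 0%N 0%N 1%N - F 0%N 0%N 0%N = 0.
  by rewrite /F !mulr1n !mulr0n !addr0 !add0r.
lra.
Qed.

End ThirdDifferences.

Section QuadraticExpansion.
Context {R : realType} {n : nat}.
Implicit Types (k e d : 'rV[int]_n).

Lemma additive_rowE (g : 'rV[int]_n -> R) : {morph g : k e / k + e} ->
  forall k, g k = \sum_i (k 0 i)%:~R * g (delta_mx 0 i).
Proof.
move=> gD k.
have g0 : g 0 = 0 by have := gD 0 0; rewrite addr0; lra.
have gN e : g (- e) = - g e by have := gD e (- e); rewrite subrr g0; lra.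
have gMn e a : g (e *+ a) = g e *+ a.
  by elim: a => [|a IH]; rewrite ?mulr0n// !mulrS gD IH.
have gMz e (c : int) : g (c *: e) = c%:~R * g e.
  rewrite -[c]intz -scalerMzl scale1r; case: c => a; first by rewrite intz gMn -mulr_natl.
  by rewrite intz NegzE mulrNz gN gMn mulrNz mulNr -mulr_natl.
rewrite {1}(row_sum_delta k) (big_morph g gD g0).
by apply: eq_bigr => i _; rewrite gMz.
Qed.

(** The mixed second difference at the origin is biadditive because mixed third
differences vanish, and A minus half its diagonal is additive; on Z^n additive
means linear. *)
Lemma quadratic_expansion (A : 'rV[int]_n -> R) : A 0 = 0 ->
  (forall d y, diff2 A d (y + d) = diff2 A d y) ->
  exists l X, symmx n X /\
    forall k, A k = edot l (rowr R k) + 2^-1 * qform X (rowr R k).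
Proof.
move=> A0 /diff2_invariant/mixed_third_eq0; rewrite A0 => H.
pose b d e := A (d + e) - A d - A e.
have bC d e : b d e = b e d by rewrite /b [e + d]addrC; lra.
have bD e : {morph b e : d d' / d + d'}.
  by move=> d d'; have := H e d d'; rewrite /b !addrA; lra.
have gD : {morph (fun k => A k - 2^-1 * b k k) : k e / k + e}.
  move=> k e; rewrite bD (bC (k + e) k) (bC (k + e) e) !bD (bC e k).
  have bE : b k e = A (k + e) - A k - A e by [].
  lra.
exists (\row_i (A (delta_mx 0 i) - 2^-1 * b (delta_mx 0 i) (delta_mx 0 i))).
exists (\matrix_(i, j) b (delta_mx 0 i) (delta_mx 0 j)); split.
  by apply/matrixP => i j; rewrite !mxE bC.
move=> k.
have -> : A k = (A k - 2^-1 * b k k) + 2^-1 * b k k by lra.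
rewrite (additive_rowE gD); congr (_ + 2^-1 * _).
  by apply: eq_bigr => i _; rewrite !mxE mulrC.
rewrite (additive_rowE (bD k)) /qform exchange_big/=; apply: eq_bigr => i _.
rewrite bC (additive_rowE (bD _)) mulr_sumr; apply: eq_bigr => j _.
by rewrite !mxE bC; ring.
Qed.

End QuadraticExpansion.

(** * Quadratic forms and topology of row vectors *)

Section RowTopology.
Context {R : realType} {n : nat}.
Implicit Types (x y z : 'rV[R]_n).

Lemma norm_row_leP x (r : R) : 0 <= r -> reflect (forall i, `|x 0 i| <= r) (`|x| <= r).
Proof.
move=> r0; rewrite [leLHS]/Num.norm/= mx_normrE.
apply: (iffP (bigmax_leP _ _ _ _)) => [[_ h] i|h]; first exact: (h (0, i)).
by split=> // -[i j] _ /=; rewrite (ord1 i).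
Qed.

Lemma cvg_row_coord {T : Type} {F : set_system T} {FF : Filter F}
    (f : T -> 'rV[R]_n) x i : f @ F --> x -> f t 0 i @[t --> F] --> x 0 i.
Proof.
move=> fx.
apply: (@continuous_cvg _ _ _ _ _ f (fun M : 'rV[R]_n => M 0 i) x); last exact: fx.
exact: coord_continuous.
Qed.

Lemma cvg_edot {T : Type} {F : set_system T} {FF : Filter F}
    (f g : T -> 'rV[R]_n) x y : f @ F --> x -> g @ F --> y ->
  edot (f t) (g t) @[t --> F] --> edot x y.
Proof.
move=> fx gy; apply: cvg_big => [|i _]; first exact: add_continuous.
by apply: cvgM; exact: cvg_row_coord.
Qed.

Lemma cvg_qform {T : Type} {F : set_system T} {FF : Filter F} (X : 'M[R]_n)
    (f : T -> 'rV[R]_n) x : f @ F --> x -> qform X (f t) @[t --> F] --> qform X x.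
Proof.
move=> fx; apply: cvg_big => [|i _]; first exact: add_continuous.
apply: cvg_big => [|j _]; first exact: add_continuous.
apply: cvgM; last exact: cvg_row_coord.
by apply: cvgM; [exact: cvg_cst|exact: cvg_row_coord].
Qed.

Lemma compact_cube (r : R) : compact [set z : 'rV[R]_n | forall i, `|z 0 i| <= r].
Proof.
have -> : [set z : 'rV[R]_n | forall i, `|z 0 i| <= r] =
    [set z : 'rV[R]_n | forall i, `[- r, r]%classic (z ord0 i)].
  by apply/seteqP; split=> z zr i; have := zr i; rewrite /= in_itv /= ler_norml.
apply: (@rV_compact _ _ (fun=> `[- r, r]%classic)) => _; exact: segment_compact.
Qed.

End RowTopology.

Section Qform.
Context {R : realType} {n : nat}.
Implicit Types (X Y : 'M[R]_n) (y z : 'rV[R]_n).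

Lemma qformE X z : qform X z = edot (z *m X) z.
Proof.
rewrite /qform exchange_big/=; apply: eq_bigr => j _.
by rewrite mxE mulr_suml; apply: eq_bigr => i _; rewrite (mulrC (X i j)).
Qed.

Lemma qformDl X Y z : qform (X + Y) z = qform X z + qform Y z.
Proof. by rewrite !qformE mulmxDr edotDl. Qed.

Lemma qformZl (c : R) X z : qform (c *: X) z = c * qform X z.
Proof. by rewrite !qformE -scalemxAr edotZl. Qed.

Lemma qformBl X Y z : qform (X - Y) z = qform X z - qform Y z.
Proof. by rewrite -(scaleN1r Y) qformDl qformZl mulN1r. Qed.

Lemma qform_scalar (c : R) z : qform c%:M z = c * edot z z.
Proof. by rewrite qformE mul_mx_scalar edotZl. Qed.

Lemma qformZr X (c : R) z : qform X (c *: z) = c ^+ 2 * qform X z.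
Proof. by rewrite !qformE -scalemxAl edotZl edotZr mulrA expr2. Qed.

Lemma qformNr X z : qform X (- z) = qform X z.
Proof. by rewrite -scaleN1r qformZr sqrrN expr1n mul1r. Qed.

Lemma qform0 X : qform X 0 = 0.
Proof. by rewrite qformE edot0r. Qed.

Lemma edot_mulmx_sym X y z : symmx n X -> edot (z *m X) y = edot (y *m X) z.
Proof.
move=> Xs; rewrite /edot.
under eq_bigr do rewrite mxE mulr_suml; under [RHS]eq_bigr do rewrite mxE mulr_suml.
rewrite exchange_big/=; apply: eq_bigr => j _; apply: eq_bigr => i _.
by rewrite -{1}Xs mxE; ring.
Qed.

Lemma qformDr X y z : symmx n X ->
  qform X (y + z) = qform X y + 2 * edot (y *m X) z + qform X z.
Proof.
move=> Xs; rewrite !qformE mulmxDl !edotDl !edotDr (edot_mulmx_sym _ _ Xs).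
by rewrite mulr2n mulrDl mul1r !addrA.
Qed.

Lemma qform_delta X i : qform X (delta_mx 0 i) = X i i.
Proof.
rewrite qformE -rowE /edot (bigD1 i)//= big1 => [|j ji]; rewrite !mxE ?eqxx ?mulr1 ?addr0//.
by rewrite (negbTE ji) mulr0.
Qed.

End Qform.

(** * From lattice bounds to touching quadratics *)

Section Interpolation.
Context {R : realType} {n : nat}.
Implicit Types (c g : 'rV[R]_n -> R) (x y z l : 'rV[R]_n) (X : 'M[R]_n).

Definition has_subgradients c := forall x, exists l, forall y, c x + edot l (y - x) <= c y.

Lemma subgradients_midconvex c : has_subgradients c -> midconvex c.
Proof.
move=> cs d x; have [l lx] := cs x.
have := lx (x + d); have := lx (x - d).
by rewrite /diff2 [x - d]addrC [x + d]addrC !addrK edotNr; lra.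
Qed.

Lemma subgradients_convex c x y (t : R) : has_subgradients c -> 0 <= t <= 1 ->
  c ((1 - t) *: x + t *: y) <= (1 - t) * c x + t * c y.
Proof.
move=> cs /andP[t0 t1]; set z := (1 - t) *: x + t *: y.
have [l lz] := cs z.
have h1 : (1 - t) * (c z + edot l (x - z)) <= (1 - t) * c x by rewrite ler_wpM2l ?subr_ge0.
have h2 : t * (c z + edot l (y - z)) <= t * c y by rewrite ler_wpM2l.
have : (1 - t) * edot l (x - z) + t * edot l (y - z) = 0.
  by rewrite !edotDr !edotNr /z edotDr !edotZr; ring.
lra.
Qed.

(** Coordinates are made real one at a time. On a unit segment in direction i a
convex function is below its chord, and the chord of the quadratic exceeds the
quadratic by at most |X i i|. The error does not depend on N. *)
Lemma lattice_interpolation g N X (a : R) l : symmx n X ->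
  (forall x y (t : R), 0 <= t <= 1 -> g ((1 - t) *: x + t *: y) <= (1 - t) * g x + t * g y) ->
  (forall e, e \in box n N ->
    g (rowr R e) <= a + edot l (rowr R e) + 2^-1 * qform X (rowr R e)) ->
  forall z, (forall i, `|z 0 i| <= N%:R) ->
    g z <= a + edot l z + 2^-1 * qform X z + n%:R * \sum_i `|X i i|.
Proof.
move=> Xs gcvx gbox; set K := \sum_i _.
have K0 : 0 <= K by exact: sumr_ge0.
suff H m z : (forall i, `|z 0 i| <= N%:R) ->
    (forall i : 'I_n, (m <= i)%N -> exists k : int, z 0 i = k%:~R) ->
    g z <= a + edot l z + 2^-1 * qform X z + m%:R * K.
  by move=> z zN; apply: H => // i; rewrite leqNgt ltn_ord.
elim: m z => [|m IH] z zN zint.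
  rewrite mul0r addr0.
  have [k kz] := choice (fun i => zint i isT).
  have zE : z = rowr R (\row_i k i) by apply/rowP => i; rewrite !mxE.
  rewrite zE; apply: gbox; apply/mem_boxP => i; rewrite mxE.
  by have := zN i; rewrite kz -intr_norm -[N%:R]/((N%:Z)%:~R) ler_int -abszE.
have mK : m%:R * K <= m.+1%:R * K by rewrite ler_wpM2r// ler_nat.
have [nm|mn] := leqP n m.
  by apply: (le_trans (IH z zN _)); rewrite ?lerD2l// => i; rewrite leqNgt (leq_trans (ltn_ord i)).
pose i := Ordinal mn.
have others (j : 'I_n) : (m <= j)%N -> j != i -> exists k : int, z 0 j = k%:~R.
  by move=> mj ji; apply: zint; rewrite ltn_neqAle mj andbT eq_sym.
pose f := Num.floor (z 0 i); pose t := z 0 i - f%:~R.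
have t0 : 0 <= t by rewrite subr_ge0 floor_le.
have t1 : t < 1 by rewrite ltrBlDl -intrD1 floorD1_gt.
have [t_eq0|t_neq0] := eqVneq t 0.
  apply: (le_trans (IH z zN _)); rewrite ?lerD2l// => j mj.
  have [->|ji] := eqVneq j i; last exact: others.
  by exists f; apply/eqP; rewrite -subr_eq0 -/t t_eq0.
have t_gt0 : 0 < t by rewrite lt_neqAle eq_sym t_neq0.
have zi := zN i; rewrite ler_norml in zi; have /andP[ziN1 ziN2] := zi.
have fN : - N%:Z <= f by rewrite floor_ge_int mulrNz.
have fN1 : f + 1 <= N%:Z.
  rewrite lezD1 -(ltr_int R); apply: lt_le_trans ziN2.
  by rewrite -subr_gt0.
pose d : 'rV[R]_n := delta_mx 0 i.
have dE j : d 0 j = (j == i)%:R by rewrite mxE eqxx.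
pose z0 := z - t *: d; pose z1 := z + (1 - t) *: d.
have z0E j : z0 0 j = if j == i then f%:~R else z 0 j.
  rewrite !mxE eqxx /=; case: eqP => [->|_]; rewrite ?mulr1 ?mulr0 ?subr0//.
  by rewrite /t; ring.
have z1E j : z1 0 j = if j == i then (f + 1)%:~R else z 0 j.
  rewrite !mxE eqxx /=; case: eqP => [->|_]; rewrite ?mulr1 ?mulr0 ?addr0//.
  by rewrite /t rmorphD/=; ring.
have IH' (w : 'rV[R]_n) (k : int) : (forall j, w 0 j = if j == i then k%:~R else z 0 j) ->
    (absz k <= N)%N -> g w <= a + edot l w + 2^-1 * qform X w + m%:R * K.
  move=> wE kN; apply: IH => j; last by move=> mj; rewrite wE; case: eqVneq => [_|/others]; [exists k|apply].
  rewrite wE; case: eqP => // _.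
  by rewrite -intr_norm -[N%:R]/((N%:Z)%:~R) ler_int -abszE.
have h0 : g z0 <= _ := IH' _ _ z0E ltac:(lia).
have h1 : g z1 <= _ := IH' _ _ z1E ltac:(lia).
have zE : z = (1 - t) *: z0 + t *: z1.
  by apply/rowP => j; rewrite !mxE; ring.
have Xii : X i i <= K.
  by rewrite /K (bigD1 i)//= (le_trans (ler_norm _))// lerDl sumr_ge0.
have q0 : qform X z0 = qform X z - 2 * t * edot (z *m X) d + t ^+ 2 * X i i.
  by rewrite /z0 -scaleNr qformDr// edotZr qformZr qform_delta; ring.
have q1 : qform X z1 = qform X z + 2 * (1 - t) * edot (z *m X) d + (1 - t) ^+ 2 * X i i.
  by rewrite /z1 qformDr// edotZr qformZr qform_delta; ring.
have l0 : edot l z0 = edot l z - t * edot l d by rewrite /z0 edotDr edotNr edotZr.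
have l1 : edot l z1 = edot l z + (1 - t) * edot l d by rewrite /z1 edotDr edotZr.
have gz : g z <= (1 - t) * g z0 + t * g z1.
  by rewrite {1}zE gcvx// t0 ltW.
apply: (le_trans gz).
apply: (@le_trans _ _ ((1 - t) * (a + edot l z0 + 2^-1 * qform X z0 + m%:R * K) +
    t * (a + edot l z1 + 2^-1 * qform X z1 + m%:R * K))).
  by apply: lerD; rewrite ler_wpM2l// subr_ge0 ltW.
rewrite q0 q1 l0 l1 -[m.+1%:R]natr1.
have tt : 0 <= t * (1 - t) <= 1.
  have t1' : 0 <= 1 - t by lra.
  by apply/andP; split; [exact: mulr_ge0|have := sqr_ge0 t; rewrite expr2; lra].
have : 2^-1 * (t * (1 - t)) * X i i <= K.
  apply: (@le_trans _ _ (2^-1 * (t * (1 - t)) * K)); first by rewrite ler_wpM2l//; lra.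
  by rewrite ler_piMl//; lra.
clearbody t K; set E := edot (z *m X) d; set ld := edot l d; move=> h.
rewrite [leLHS](_ : _ = a + edot l z + 2^-1 * qform X z + m%:R * K +
  2^-1 * (t * (1 - t)) * X i i); last by field.
lra.
Qed.

(** One-sided second-order expansion on the lattice points of an arbitrarily large
box, at some arbitrarily small scale s and near xh, but not necessarily at xh
itself. The slack 1 is s^2 in the original variables, negligible against the
square of the width s N of the box. *)
Definition approx_above c xh X := forall N (delta : R), 0 < delta -> exists x s l,
  [/\ 0 < s, `|x - xh| <= delta, s * N%:R <= delta &
   forall e, e \in box n N -> c (x + s *: rowr R e) <=
     c x + s * edot l (rowr R e) + s ^+ 2 * (2^-1 * qform X (rowr R e) + 1)].

(** After interpolation, c exceeds the quadratic of Hessian X by at most K s^2 on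
a box of half-width s N. Adding eps/2 times the squared distance dominates
this at the boundary when N is large, so that the maximum of c minus the
quadratic of Hessian X + eps is interior. *)
Lemma approx_above_touching c xh X : continuous c -> has_subgradients c -> symmx n X ->
  approx_above c xh X -> forall eps, 0 < eps -> exists x1 p, `|x1 - xh| <= eps /\
    \forall z \near (0 : 'rV[R]_n),
      c (x1 + z) <= c x1 + edot p z + 2^-1 * qform (X + eps%:M) z.
Proof.
move=> cc cs Xs capp eps eps0.
pose K := n%:R * \sum_i `|X i i| + 1.
have K0 : 0 < K by rewrite ltr_wpDl// mulr_ge0// sumr_ge0.
(* A box so large that eps / 2 times its squared half-width beats the interpolation error. *)
have [N NK] : exists N : nat, 2 * K / eps + 1 <= N%:R.
  by exists (Num.bound (2 * K / eps + 1)); apply/ltW/archi_boundP; rewrite addr_ge0// divr_ge0 ?mulr_ge0// ltW.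
have [x [s [l [s0 xxh sN cbox]]]] := capp N (eps / 2) ltac:(by rewrite divr_gt0).
have s2 : 0 < s ^+ 2 by rewrite exprn_gt0.
pose g z := c (x + s *: z) / s ^+ 2.
have gle z : (forall i, `|z 0 i| <= N%:R) ->
    c (x + s *: z) <= c x + s * edot l z + s ^+ 2 * (2^-1 * qform X z + K).
  have gcvx y z' (t : R) : 0 <= t <= 1 ->
      g ((1 - t) *: y + t *: z') <= (1 - t) * g y + t * g z'.
    move=> t01; rewrite /g !mulrA -mulrDl ler_pM2r ?invr_gt0//.
    rewrite (_ : x + _ = (1 - t) *: (x + s *: y) + t *: (x + s *: z')).
      exact: subgradients_convex.
    by apply/rowP => j; rewrite !mxE; ring.
  have gbox e : e \in box n N -> g (rowr R e) <=
      (c x / s ^+ 2 + 1) + edot (s^-1 *: l) (rowr R e) + 2^-1 * qform X (rowr R e).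
    move=> /cbox; rewrite /g ler_pdivrMr// edotZl.
    move=> h; apply: (le_trans h); rewrite le_eqVlt; apply/orP; left; apply/eqP.
    by field; rewrite gt_eqF.
  move=> zN; have := lattice_interpolation Xs gcvx gbox zN.
  rewrite /g ler_pdivrMr// edotZl => h; apply: (le_trans h).
  rewrite le_eqVlt; apply/orP; left; apply/eqP.
  by rewrite /K; field; rewrite gt_eqF.
pose X' := X + eps%:M.
have X's : symmx n X' by rewrite /symmx /X' /= linearD/= tr_scalar_mx Xs.
pose B := [set z : 'rV[R]_n | forall i, `|z 0 i| <= N%:R].
pose G z := c (x + s *: z) - (s * edot l z + s ^+ 2 * (2^-1 * qform X' z)).
have cG : continuous G.
  suff GF z (F : set_system 'rV[R]_n) : Filter F -> w @[w --> F] --> z -> G w @[w --> F] --> G z.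
    by move=> z; exact: (GF z (nbhs z) _ cvg_id).
  move=> FF Fz; apply: cvgB.
    have xsF : x + s *: w @[w --> F] --> x + s *: z.
      by apply: cvgD; [exact: cvg_cst|apply: cvgZ => //; exact: cvg_cst].
    exact: (continuous_cvg _ (cc _) xsF).
  apply: cvgD; apply: cvgM; try exact: cvg_cst.
    by apply: cvg_edot => //; exact: cvg_cst.
  by apply: cvgM; [exact: cvg_cst|exact: cvg_qform].
have B0 : B 0 by move=> i; rewrite mxE normr0.
have [z1 /set_mem z1B z1max] := compact_EVT_max (ex_intro _ _ B0) (@compact_cube _ _ _)
  (continuous_subspaceT cG).
have {}z1max z : B z -> G z <= G z1 by move=> Bz; apply: z1max; exact: mem_set.
have z1_int i : `|z1 0 i| < N%:R.
  rewrite ltNge; apply/negP => Nz1.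
  have := z1max 0 B0; rewrite /G scaler0 addr0 edot0r qform0 !mulr0 addr0 subr0.
  have := gle z1 z1B; rewrite /X' qformDl qform_scalar => h1 h2.
  have : s ^+ 2 * 0 <= s ^+ 2 * (K - 2^-1 * (eps * edot z1 z1)) by rewrite mulr0; lra.
  rewrite ler_pM2l//.
  have z1N : N%:R ^+ 2 <= edot z1 z1.
    apply: le_trans (edot_ge_sqr z1 i); rewrite -[leRHS]real_normK ?num_real//.
    by rewrite lerXn2r ?nnegrE.
  have epsN : 2 * K + eps <= eps * N%:R.
    by move: NK; rewrite -lerBrDr ler_pdivrMr//; lra.
  have N1 : 1 <= N%:R :> R.
    by apply: le_trans NK; rewrite lerDr divr_ge0 ?mulr_ge0// ltW.
  have : eps * N%:R <= eps * edot z1 z1.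
    by rewrite ler_wpM2l ?(ltW eps0)//; nra.
  lra.
exists (x + s *: z1), (l + s *: (z1 *m X')); split.
  rewrite addrAC; apply: le_trans (ler_normD _ _) _; rewrite normrZ gtr0_norm//.
  have : s * `|z1| <= s * N%:R by rewrite ler_wpM2l ?(ltW s0)//; apply/norm_row_leP.
  lra.
have near_B : \forall z \near (0 : 'rV[R]_n), forall i, `|(z1 + s^-1 *: z) 0 i| < N%:R.
  suff nB (F : set_system 'rV[R]_n) : Filter F -> w @[w --> F] --> (0 : 'rV[R]_n) ->
      \forall z \near F, forall i, `|(z1 + s^-1 *: z) 0 i| < N%:R.
    exact: (nB (nbhs (0 : 'rV[R]_n)) _ cvg_id).
  move=> FF F0; apply: filter_forall => i; apply: (@cvgr_norm_lt _ _ _ _ _ _ (z1 0 i)) => //.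
  apply: cvg_row_coord; rewrite -[X in _ --> X](addr0 z1) -(scaler0 _ s^-1).
  by apply: cvgD; [exact: cvg_cst|apply: cvgZ => //; exact: cvg_cst].
near=> z.
have zB : B (z1 + s^-1 *: z) by move=> i; apply: ltW; move: i; near: z.
have := z1max _ zB; rewrite /G -/X'.
have -> : x + s *: (z1 + s^-1 *: z) = x + s *: z1 + z.
  by rewrite scalerDr scalerA divff ?gt_eqF// scale1r addrA.
rewrite qformDr// qformZr edotDr !edotDl !edotZr edotZl.
have -> : s ^+ 2 * (2^-1 * (qform X' z1 + 2 * (s^-1 * edot (z1 *m X') z) + s^-1 ^+ 2 * qform X' z)) =
   s ^+ 2 * (2^-1 * qform X' z1) + s * edot (z1 *m X') z + 2^-1 * qform X' z.
  by field; rewrite gt_eqF.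
have -> : s * (edot l z1 + s^-1 * edot l z) = s * edot l z1 + edot l z.
  by field; rewrite gt_eqF.
lra.
Unshelve. all: by end_near. Qed.

End Interpolation.

(** * Limits along an ultrafilter *)

Section Ultralimits.
Context {T : Type} {U : set_system T} {UU : UltraFilter U}.

(** Convergence of a function along a given ultrafilter replaces the extraction of
subsequences, and lets countably many limits be taken at once. *)
Lemma ultra_compact_cvg {V : topologicalType} (K : set V) (f : T -> V) :
  compact K -> (\forall t \near U, K (f t)) -> exists2 p, K p & f @ U --> p.
Proof.
move=> cK fK; have [p [Kp clp]] := cK (f @ U) _ fK.
exists p => // A pA; have [//|UnA] := in_ultra_setVsetC (f @^-1` A) UU.
by have [q [nAq Aq]] := clp (~` A) A UnA pA.
Qed.

Lemma near_all_seq {I : eqType} (s : seq I) (P : I -> T -> Prop) :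
  (forall i, i \in s -> \forall t \near U, P i t) ->
  \forall t \near U, forall i, i \in s -> P i t.
Proof.
elim: s => [|i s IH] h; first by apply: filterE.
have h1 := h i (mem_head _ _); have h2 := IH (fun j js => h j (mem_behead (s := i :: s) js)).
by apply: filterS2 h1 h2 => t h1 h2 j; rewrite inE => /predU1P[->|/h2].
Qed.

End Ultralimits.

(** The equality case of Jensen's inequality for the strictly convex 1/(1 + q). *)
Lemma defect_le0_diff2 {R : realType} {V : zmodType} (f : V -> R) d y :
  midconvex f -> defect f 0 d y <= 0 -> diff2 f d (y + d) = diff2 f d y.
Proof.
move=> cf; rewrite /defect flatnessS /flatness expr0 !divr1 expn0 mulr1n.
set p := diff2 f d (y + d); set q := diff2 f d y; set r := diff2 f d (y - d).
have p0 : 0 <= p by exact: cf.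
have q0 : 0 <= q by exact: cf.
have r0 : 0 <= r by exact: cf.
rewrite inv1D_jensen//; set m := (_ / 4).
have m0 : 0 <= m by rewrite /m; lra.
rewrite pmulr_rle0; last by rewrite invr_gt0 exprn_gt0//; lra.
have sq_ge0 (x z : R) : 0 <= x -> 0 <= z ^+ 2 / (1 + x).
  by move=> x0; rewrite mulr_ge0 ?sqr_ge0// invr_ge0 addr_ge0.
have sq_eq0 x : 0 <= x -> (x - m) ^+ 2 / (1 + x) = 0 -> x = m.
  move=> x0 /eqP; rewrite mulf_eq0 invr_eq0 sqrf_eq0 subr_eq0 => /orP[/eqP//|].
  by rewrite gt_eqF//; lra.
have hp := sq_ge0 p (p - m) p0; have hq := sq_ge0 q (q - m) q0.
have hr := sq_ge0 r (r - m) r0 => h.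
have [P0 Q0] : (p - m) ^+ 2 / (1 + p) = 0 /\ (q - m) ^+ 2 / (1 + q) = 0.
  move: hp hq hr h; move: (_ / (1 + p)) (_ / (1 + q)) (_ / (1 + r)) => P Q S.
  by clear; move=> *; split; lra.
by rewrite (sq_eq0 p p0 P0) (sq_eq0 q q0 Q0).
Qed.

Section LimitOfBlowups.
Context {R : realType} {n : nat} {U : set_system nat} {UU : UltraFilter U}.
Hypothesis Uoo : \oo `<=` U.

(** The limit function has zero defects, hence second differences that are
invariant along their own direction. *)
Lemma quadratic_limit (A : nat -> 'rV[int]_n -> R) :
  (forall m, A m 0 = 0) -> (forall m, midconvex (A m)) ->
  (forall e, exists C, \forall m \near \oo, `|A m e| <= C) ->
  (forall d y, \forall m \near \oo, defect (A m) 0 d y <= m.+1%:R^-1) ->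
  exists l X, symmx n X /\
    forall k, A m k @[m --> U] --> edot l (rowr R k) + 2^-1 * qform X (rowr R k).
Proof.
move=> A0 Acvx Abnd Adef.
have UF : ProperFilter U by exact: ultra_proper.
have Alim e : exists L : R, A m e @[m --> U] --> L.
  have [C AC] := Abnd e.
  have [|L _ AL] := @ultra_compact_cvg _ U UU _ _ (A ^~ e) (@segment_compact R (- C) C).
    by apply: Uoo; apply: filterS AC => m /=; rewrite in_itv/= ler_norml.
  by exists L.
have [L AL] := choice Alim.
have dL d y : diff2 (A m) d y @[m --> U] --> diff2 L d y.
  by apply: cvgB; [apply: cvgD|apply: cvgM]; try exact: AL; exact: cvg_cst.
have Lcvx : midconvex L.
  by move=> d y; apply: (cvgr_to_ge (dL d y)); apply: filterE => m; exact: Acvx.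
have fL j d y : flatness (A m) j d y @[m --> U] --> flatness L j d y.
  apply: cvgV; first by rewrite gt_eqF// ltr_wpDr// mulr_ge0// invr_ge0 exprn_ge0.
  by apply: cvgD; [exact: cvg_cst|apply: cvgM; [exact: dL|exact: cvg_cst]].
have defL d y : defect (A m) 0 d y @[m --> U] --> defect L 0 d y.
  apply: cvgB; last exact: fL.
  by apply: cvgD; [apply: cvgD|]; (apply: cvgM; [exact: cvg_cst|exact: fL]).
have L0 : L 0 = 0.
  have A00 : A m 0 @[m --> U] --> (0 : R).
    by rewrite (_ : (fun m => A m 0) = cst 0); [exact: cvg_cst|apply/funext].
  exact: norm_cvg_unique (AL 0) A00.
have harm : m.+1%:R^-1 @[m --> U] --> (0 : R).
  by apply: cvg_trans (@cvg_harmonic R) => S; exact: Uoo.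
have [l [X [Xs LE]]] : exists l X, symmx n X /\
    forall k, L k = edot l (rowr R k) + 2^-1 * qform X (rowr R k).
  apply: quadratic_expansion => // d y; apply: defect_le0_diff2 => //.
  exact: (ler_cvg_to (defL d y) harm (Uoo (Adef d y))).
by exists l, X; split => // k; rewrite -LE.
Qed.

End LimitOfBlowups.

(** By homogeneity the inequality holds at rational points, which are dense. *)
Lemma qform_ge0_int {R : realType} {n : nat} (X : 'M[R]_n) :
  (forall k, 0 <= qform X (rowr R k)) -> forall z, 0 <= qform X z.
Proof.
move=> Xint z.
pose k (t : nat) : 'rV[int]_n := \row_i Num.floor (t.+1%:R * z 0 i).
have kz : t.+1%:R^-1 *: rowr R (k t) @[t --> \oo] --> z.
  apply/cvgrPdist_le => e e0.
  have [N _ hN] := near_infty_natSinv_lt (PosNum e0).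
  exists N => // t Nt; apply: le_trans (ltW (hN t Nt)).
  apply/norm_row_leP => [|i]; first by rewrite invr_ge0.
  rewrite !mxE; set u := t.+1%:R * z 0 i.
  have t0 : 0 < t.+1%:R :> R by rewrite ltr0n.
  rewrite -[z 0 i](mulKf (lt0r_neq0 t0)) -/u -mulrBr normrM gtr0_norm ?invr_gt0//.
  rewrite ler_piMr ?invr_ge0// ger0_norm ?subr_ge0 ?floor_le//.
  by rewrite lerBlDl ltW// -intrD1 floorD1_gt.
apply: (cvgr_to_ge (cvg_qform (X := X) kz)).
by apply: filterE => t; rewrite qformZr mulr_ge0 ?sqr_ge0.
Qed.

(** * Rescalings of convex functions at a contact point *)

(** Parabolic rescaling of c around x at scale s, read on the lattice Z^n, with
the affine part of slope l removed. *)
Definition blow (R : realType) (n : nat) (c : 'rV[R]_n -> R) (x : 'rV[R]_n) (s : R)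
    (l : 'rV[R]_n) (e : 'rV[int]_n) : R :=
  (c (x + s *: rowr R e) - c x - s * edot l (rowr R e)) / s ^+ 2.

Section Blow.
Context {R : realType} {n : nat}.
Implicit Types (c : 'rV[R]_n -> R) (x l : 'rV[R]_n) (s h : R) (e d y k : 'rV[int]_n).

Lemma blow0 c x s l : blow c x s l 0 = 0.
Proof. by rewrite /blow rowr0 scaler0 addr0 edot0r; ring. Qed.

Lemma diff2_blow c x s l d y :
  diff2 (blow c x s l) d y = diff2 c (s *: rowr R d) (x + s *: rowr R y) / s ^+ 2.
Proof.
rewrite /diff2 /blow rowrD rowrD rowrN !scalerDr !scalerN !addrA !edotDr !edotNr.
ring.
Qed.

Lemma blow_midconvex c x s l : midconvex c -> midconvex (blow c x s l).
Proof.
by move=> cc d y; rewrite diff2_blow mulr_ge0 ?cc// invr_ge0 sqr_ge0.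
Qed.

Lemma flatness_blow c x h l l' j i d k y :
  flatness (blow c x h l) (j + i) d (k + y *+ 2 ^ j) =
  flatness (blow c (x + h *: rowr R k) (h * 2 ^+ j) l') i d y.
Proof.
rewrite /flatness !diff2_blow rowrD !rowrMn scalerDr !scalerA addrA.
rewrite expnD natrM !natrX (mulrA h); congr (1 + _)^-1.
have -> : (h * 2 ^+ j) ^+ 2 = h ^+ 2 * 4 ^+ j.
  by rewrite exprMn exprAC; congr (_ * _ ^+ _); ring.
by rewrite exprD !invfM !mulrA.
Qed.

(** A scale-j defect of a lattice function becomes a scale-0 defect of its
rescaling around k by 2^j. *)
Lemma defect_blow c x h l l' j d k y :
  defect (blow c x h l) j d (k + y *+ 2 ^ j) =
  defect (blow c (x + h *: rowr R k) (h * 2 ^+ j) l') 0 d y.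
Proof.
have F0 z := flatness_blow c x h l l' j 0 d k z.
have F1 := flatness_blow c x h l l' j 1 d k y.
rewrite addn1 in F1; rewrite /defect F1 expn0 mulr1n.
have -> : k + y *+ 2 ^ j + d *+ 2 ^ j = k + (y + d) *+ 2 ^ j by rewrite mulrnDl addrA.
have -> : k + y *+ 2 ^ j - d *+ 2 ^ j = k + (y - d) *+ 2 ^ j by rewrite mulrnBl addrA.
by move: (F0 (y + d)) (F0 y) (F0 (y - d)); rewrite addn0 => -> -> ->.
Qed.

End Blow.

Section SumsLemma.
Context {R : realType} {n : nat}.
Variables (a b : 'rV[R]_n -> R) (xh : 'rV[R]_n) (M : R).
Hypotheses (as_ : has_subgradients a) (bs : has_subgradients b).
Hypothesis ab_le : forall x, a x + b x <= edot x x + M.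
Hypothesis ab_eq : a xh + b xh = edot xh xh + M.

(** The mesh h is chosen after the size N of the box given by [discrete_blowup],
so that the box has half-width 1/m in the original variables. *)
Lemma good_blowup m : (0 < m)%N -> exists x s, [/\ 0 < s, `|x - xh| <= m%:R^-1,
  s * m%:R <= m%:R^-1 & forall l l',
  (forall e, e \in box n m -> diff2 (blow a x s l) e 0 + diff2 (blow b x s l') e 0 <=
     2 * (1 + m%:R^-1) * edot (rowr R e) (rowr R e)) /\
  (forall d y, d \in box n m -> y \in box n m ->
     defect (blow a x s l) 0 d y <= m%:R^-1 /\ defect (blow b x s l') 0 d y <= m%:R^-1)].
Proof.
move=> m_gt0; have [N [N_gt0 HN]] := @discrete_blowup R n m m_gt0.
have m0 : 0 < m%:R :> R by rewrite ltr0n.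
have N0 : 0 < N%:R :> R by rewrite ltr0n.
pose h : R := (m%:R * N%:R)^-1.
have h0 : 0 < h by rewrite invr_gt0 mulr_gt0.
have hN : h * N%:R = m%:R^-1 by rewrite /h; field; rewrite !gt_eqF.
have ac := subgradients_midconvex as_; have bc := subgradients_midconvex bs.
(* The slope 2 xh is that of |x|^2 at xh; removing it from a alone turns the
   bound on a + b into A + B <= |k|^2. *)
pose A := blow a xh h (2 *: xh); pose B := blow b xh h 0.
have AB0 : A 0 + B 0 = 0 by rewrite /A /B !blow0 addr0.
have ABle k : A k + B k <= edot (rowr R k) (rowr R k).
  rewrite /A /B /blow -mulrDl ler_pdivrMr ?exprn_gt0// edot0l edotZl.
  have := ab_le (xh + h *: rowr R k).
  rewrite !(edotDl, edotDr, edotZl, edotZr) (edotC (rowr R k) xh).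
  move: ab_eq; lra.
have [k [j [kN jN ctc dfc]]] := HN A B (blow_midconvex _ _ _ ac) (blow_midconvex _ _ _ bc) AB0 ABle.
exists (xh + h *: rowr R k), (h * 2 ^+ j); split.
- by rewrite mulr_gt0// exprn_gt0.
- rewrite addrC addKr normrZ gtr0_norm// -hN ler_wpM2l ?(ltW h0)//.
  apply/norm_row_leP => // i; rewrite mxE -intr_norm -[N%:R]/((N%:Z)%:~R) ler_int -abszE.
  by move/mem_boxP: kN; exact.
- by rewrite -mulrA -hN ler_wpM2l ?(ltW h0)// -natrX -natrM ler_nat mulnC.
move=> l l'; split=> [e em|d y dm ym].
  have := ctc e em; rewrite /A /B !diff2_blow rowr0 scaler0 addr0 rowrMn scalerA natrX.
  have -> : (h * 2 ^+ j) ^+ 2 = h ^+ 2 * 4 ^+ j.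
    by rewrite exprMn exprAC; congr (_ * _ ^+ _); ring.
  rewrite -!mulrDl !ler_pdivrMr ?mulr_gt0 ?exprn_gt0// => H; apply: le_trans H _.
  by rewrite le_eqVlt; apply/orP; left; apply/eqP; ring.
by have := dfc d y dm ym; rewrite /A /B (defect_blow _ _ _ _ l) (defect_blow _ _ _ _ l').
Qed.

Lemma box_exhaust e : exists N, e \in box n N.
Proof.
exists (\sum_i absz (e 0%R i))%N; apply/mem_boxP => i.
by rewrite (bigD1 i)//= leq_addr.
Qed.

(** Subtracting the tangent given by a subgradient makes the rescaled functions
nonnegative, and their sums over opposite points are second differences, which
the contact property bounds: this is the compactness needed for a limit, and in
the limit the contact property becomes X + Y <= 2I on Z^n. *)
Lemma convex_sums_approx : exists X Y, [/\ symmx n X, symmx n Y,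
  forall z, qform X z + qform Y z <= 2 * edot z z,
  approx_above a xh X & approx_above b xh Y].
Proof.
have [U [UU Uoo]] := @ultraFilterLemma nat \oo _.
have UF : ProperFilter U by exact: ultra_proper.
have [x xP] := choice (fun m => good_blowup (ltn0Sn m)).
have [s sP] := choice xP; move: sP => {xP} xsP.
have [la laP] := choice as_; have [lb lbP] := choice bs.
pose A m := blow a (x m) (s m) (la (x m)); pose B m := blow b (x m) (s m) (lb (x m)).
have ac := subgradients_midconvex as_; have bc := subgradients_midconvex bs.
have blow_ge0 c (l : 'rV[R]_n) y (t : R) e : 
    (forall y', c y + edot l (y' - y) <= c y') -> 0 <= blow c y t l e.
  move=> ly; rewrite /blow mulr_ge0 ?invr_ge0 ?sqr_ge0//.
  have := ly (y + t *: rowr R e).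
  by rewrite (_ : y + _ - y = t *: rowr R e) ?edotZr; [lra|rewrite addrC addKr].
have A0 m : A m 0 = 0 by exact: blow0.
have B0 m : B m 0 = 0 by exact: blow0.
have A_ge0 m e : 0 <= A m e by apply: blow_ge0; exact: laP.
have B_ge0 m e : 0 <= B m e by apply: blow_ge0; exact: lbP.
have in_box e : \forall m \near \oo, e \in box n m.+1.
  have [N eN] := box_exhaust e; exists N => // m /= Nm.
  by apply: box_sub eN; rewrite ltnW.
have contact e : \forall m \near \oo, diff2 (A m) e 0 + diff2 (B m) e 0 <=
     2 * (1 + m.+1%:R^-1) * edot (rowr R e) (rowr R e).
  by apply: filterS (in_box e) => m em; have [_ _ _ /(_ (la (x m)) (lb (x m)))[->]] := xsP m.
have defects d y : \forall m \near \oo,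
    defect (A m) 0 d y <= m.+1%:R^-1 /\ defect (B m) 0 d y <= m.+1%:R^-1.
  apply: filterS2 (in_box d) (in_box y) => m dm ym.
  by have [_ _ _ /(_ (la (x m)) (lb (x m)))[_ /(_ d y dm ym)]] := xsP m.
have diff20 (f : 'rV[int]_n -> R) e : f 0 = 0 -> diff2 f e 0 = f e + f (- e).
  by move=> f0; rewrite /diff2 f0 add0r sub0r mulr0 subr0.
have bounds e : exists C, \forall m \near \oo, `|A m e| <= C /\ `|B m e| <= C.
  exists (4 * edot (rowr R e) (rowr R e)); apply: filterS (contact e) => m.
  rewrite !diff20// => h; rewrite !ger0_norm//.
  have m1 : m.+1%:R^-1 <= 1 :> R by rewrite invf_le1 ?ltr0n// ler1n.
  have := A_ge0 m e; have := B_ge0 m e; have := A_ge0 m (- e); have := B_ge0 m (- e).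
  have : 2 * (1 + m.+1%:R^-1) * edot (rowr R e) (rowr R e) <= 4 * edot (rowr R e) (rowr R e).
    by rewrite ler_wpM2r ?edot_ge0//; move: (m.+1%:R^-1) m1 => mu; lra.
  by move=> /(le_trans h) {}h ? ? ? ?; split; lra.
have [l [X [Xs AX]]] : exists l X, symmx n X /\ forall k,
    A m k @[m --> U] --> edot l (rowr R k) + 2^-1 * qform X (rowr R k).
  apply: (quadratic_limit Uoo) => [m|m|e|d y]; first exact: blow0.
  - exact: blow_midconvex.
  - by have [C hC] := bounds e; exists C; apply: filterS hC => m [].
  - by apply: filterS (defects d y) => m [].
have [l' [Y [Ys BY]]] : exists l X, symmx n X /\ forall k,
    B m k @[m --> U] --> edot l (rowr R k) + 2^-1 * qform X (rowr R k).
  apply: (quadratic_limit Uoo) => [m|m|e|d y]; first exact: blow0.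
  - exact: blow_midconvex.
  - by have [C hC] := bounds e; exists C; apply: filterS hC => m [].
  - by apply: filterS (defects d y) => m [].
have harm : m.+1%:R^-1 @[m --> U] --> (0 : R).
  by apply: cvg_trans (@cvg_harmonic R) => S; exact: Uoo.
have approx c (g : 'rV[R]_n -> 'rV[R]_n) L Z :
    (forall k, blow c (x m) (s m) (g (x m)) k @[m --> U] -->
        edot L (rowr R k) + 2^-1 * qform Z (rowr R k)) -> approx_above c xh Z.
  move=> lim N delta delta0.
  have hbox : \forall m \near U, forall e, e \in box n N ->
      blow c (x m) (s m) (g (x m)) e <= edot L (rowr R e) + 2^-1 * qform Z (rowr R e) + 1.
    apply: near_all_seq => e _; have := @cvgr_le _ _ _ _ _ _ (lim e).
    by apply; rewrite ltrDl.
  have hdelta : \forall m \near U, m.+1%:R^-1 < delta.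
    exact/Uoo/(near_infty_natSinv_lt (PosNum delta0)).
  have hN : \forall m \near U, (N <= m.+1)%N.
    by apply: Uoo; exists N => // m /= /leqW.
  have [m [mbox [mdelta mN]]] := filter_ex (filterI hbox (filterI hdelta hN)).
  have [s0 xxh sm _] := xsP m.
  exists (x m), (s m), (g (x m) + s m *: L); split => //.
  - by rewrite (le_trans xxh)// ltW.
  - apply: le_trans (ltW mdelta); apply: le_trans sm.
    by rewrite ler_wpM2l ?(ltW s0)// ler_nat.
  - move=> e /mbox; rewrite /blow ler_pdivrMr ?exprn_gt0// edotDl edotZl; lra.
exists X, Y; split => //; [|exact: approx AX|exact: approx BY].
move=> z; have : 0 <= qform (2%:M - (X + Y)) z.
  have sub_qform w : qform (2%:M - (X + Y)) w = 2 * edot w w - (qform X w + qform Y w).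
    by rewrite qformBl qform_scalar qformDl.
  apply: qform_ge0_int z => k; rewrite sub_qform subr_ge0.
  have dlim (f : nat -> 'rV[int]_n -> R) L Z : (forall m, f m 0 = 0) ->
      (forall k, f m k @[m --> U] --> edot L (rowr R k) + 2^-1 * qform Z (rowr R k)) ->
      diff2 (f m) k 0 @[m --> U] --> qform Z (rowr R k).
    move=> f0 fL; under eq_fun do rewrite diff20//.
    have -> : qform Z (rowr R k) = (edot L (rowr R k) + 2^-1 * qform Z (rowr R k)) +
        (edot L (rowr R (- k)) + 2^-1 * qform Z (rowr R (- k))).
      by rewrite rowrN edotNr qformNr; lra.
    by apply: cvgD; exact: fL.
  have lhs : diff2 (A m) k 0 + diff2 (B m) k 0 @[m --> U] -->
      qform X (rowr R k) + qform Y (rowr R k).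
    by apply: cvgD; [exact: dlim A0 AX|exact: dlim B0 BY].
  have rhs : 2 * (1 + m.+1%:R^-1) * edot (rowr R k) (rowr R k) @[m --> U] -->
      2 * (1 + 0) * edot (rowr R k) (rowr R k).
    by apply: cvgM; [apply: cvgM; [|apply: cvgD]|]; try exact: cvg_cst.
  have := ler_cvg_to lhs rhs (Uoo _ (contact k)).
  by rewrite addr0 mulr1; exact.
by rewrite qformBl qform_scalar qformDl; lra.
Qed.

End SumsLemma.

(** * Sup-convolutions *)

(** The matrices X and Y do not depend on eps; only the points and slopes do. *)
Lemma convex_sums_jets {R : realType} {n : nat} (a b : 'rV[R]_n -> R) xh M :
  continuous a -> continuous b -> has_subgradients a -> has_subgradients b ->
  (forall x, a x + b x <= edot x x + M) -> a xh + b xh = edot xh xh + M ->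
  exists X Y, [/\ symmx n X, symmx n Y,
   forall z, qform X z + qform Y z <= 2 * edot z z &
   forall eps, 0 < eps ->
     (exists x p, `|x - xh| <= eps /\ \forall z \near (0 : 'rV[R]_n),
        a (x + z) <= a x + edot p z + 2^-1 * qform (X + eps%:M) z) /\
     (exists x p, `|x - xh| <= eps /\ \forall z \near (0 : 'rV[R]_n),
        b (x + z) <= b x + edot p z + 2^-1 * qform (Y + eps%:M) z)].
Proof.
move=> ca cb sa sb ab_le ab_eq.
have [X [Y [Xs Ys XY aX bY]]] := convex_sums_approx sa sb ab_le ab_eq.
exists X, Y; split=> // eps eps0; split; exact: approx_above_touching.
Qed.

Lemma edot_norm_le {R : realType} {n : nat} (C : R) (y z : 'rV[R]_n) : 
  (forall i, `|y 0 i| <= C) -> `|edot y z| <= n%:R * C * `|z|.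
Proof.
move=> yC; apply: (le_trans (ler_norm_sum _ _ _)).
rewrite -mulrA -[n in n%:R](card_ord n) mulr_natl -sumr_const; apply: ler_sum => i _.
rewrite normrM ler_pM//.
by have /norm_row_leP := lexx `|z|; apply; rewrite normr_ge0.
Qed.

(** Along t d the left side is linear in t and the right side quadratic. *)
Lemma linear_le_quadratic {R : realType} {n : nat} (d : 'rV[R]_n) (Z : 'M[R]_n) :
  (\forall w \near (0 : 'rV[R]_n), edot d w <= 2^-1 * qform Z w) -> d = 0.
Proof.
move=> near_le; apply: edot_eq0; apply/eqP; rewrite eq_le edot_ge0 andbT.
have lim : t.+1%:R^-1 *: d @[t --> \oo] --> (0 : 'rV[R]_n).
  by rewrite -[X in _ --> X](scale0r d); apply: cvgZ; [exact: cvg_harmonic|exact: cvg_cst].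
have rhs : 2^-1 * (t.+1%:R^-1 * qform Z d) @[t --> \oo] --> 2^-1 * (0 * qform Z d).
  apply: cvgM; first exact: cvg_cst.
  by apply: cvgM; [exact: cvg_harmonic|exact: cvg_cst].
have : \forall t \near \oo, edot d d <= 2^-1 * (t.+1%:R^-1 * qform Z d).
  have := lim _ near_le; apply: (@filterS _ \oo) => t /=.
  have t0 : 0 < t.+1%:R^-1 :> R by rewrite invr_gt0 ltr0n.
  rewrite edotZr qformZr => h; rewrite -(ler_pM2l t0); apply: (le_trans h).
  by rewrite le_eqVlt; apply/orP; left; apply/eqP; ring.
by move=> /(cvgr_to_ge rhs); rewrite mul0r mulr0; apply.
Qed.

Lemma compact_coord_bound {R : realType} {n : nat} (K : set 'rV[R]_n) : compact K ->
  exists2 C : R, 0 < C & forall y, K y -> forall i, `|y 0 i| <= C.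
Proof.
move=> cK; have /ex_strict_bound_gt0[C C0 KC] := compact_bounded cK.
by exists C => // y Ky; apply/norm_row_leP; [exact: ltW|apply/ltW/KC].
Qed.

Section SupConvolution.
Context {R : realType} {n : nat}.
Variables (K : set 'rV[R]_n) (w : 'rV[R]_n -> R).
Hypotheses (K_compact : compact K) (w_cont : {within K, continuous w}).

Definition supconv_at (x y : 'rV[R]_n) : R := w y - 2^-1 * edot y y + edot x y.

Lemma cvg_supconv_at {T : Type} {F : set_system T} {FF : Filter F}
    (g f : T -> 'rV[R]_n) x y :
  w (f t) @[t --> F] --> w y -> f @ F --> y -> g @ F --> x ->
  supconv_at (g t) (f t) @[t --> F] --> supconv_at x y.
Proof.
move=> wf fy gx; apply: cvgD; last exact: cvg_edot.
by apply: cvgB => //; apply: cvgM; [exact: cvg_cst|exact: cvg_edot].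
Qed.

Definition supconv_argmax (x y : 'rV[R]_n) :=
  K y /\ forall y', K y' -> supconv_at x y' <= supconv_at x y.

Lemma supconv_argmax_exists x : K !=set0 -> exists y, supconv_argmax x y.
Proof.
move=> K0; have cg : {within K, continuous (supconv_at x)}.
  apply/subspace_continuousP => y Ky; apply: cvg_supconv_at.
  - by have /subspace_continuousP := w_cont; exact.
  - exact: cvg_within.
  - exact: cvg_cst.
have [y /set_mem Ky ymax] := compact_EVT_max K0 K_compact cg.
by exists y; split=> // y' Ky'; apply: ymax; exact: mem_set.
Qed.

Variable Y : 'rV[R]_n -> 'rV[R]_n.
Hypothesis YE : forall x, supconv_argmax x (Y x).

Definition supconv x := supconv_at x (Y x).

(** Maximisers at x are subgradients at x: the supremum is at least the affine
function given by y. *)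
Lemma supconv_subgradient x y : supconv_argmax x y ->
  forall x', supconv x + edot y (x' - x) <= supconv x'.
Proof.
move=> [Ky ymax] x'; have [Kx Yx] := YE x; have [_ /(_ y Ky)] := YE x'.
have := ymax _ Kx; rewrite /supconv /supconv_at edotDr edotNr (edotC y) (edotC y).
lra.
Qed.

Lemma supconv_has_subgradients : has_subgradients supconv.
Proof. by move=> x; exists (Y x); exact: supconv_subgradient. Qed.

Lemma supconv_continuous : continuous supconv.
Proof.
have [C C0 KC] := compact_coord_bound K_compact.
have D0 : 0 < n%:R * C + 1 by rewrite ltr_wpDl// mulr_ge0// ltW.
have half x x' : supconv x - supconv x' <= (n%:R * C + 1) * `|x - x'|.
  have := supconv_subgradient (YE x) x'; have [KY _] := YE x.
  have := edot_norm_le (x - x') (KC _ KY); rewrite ler_norml => /andP[_ h1 h2].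
  have : n%:R * C * `|x - x'| <= (n%:R * C + 1) * `|x - x'| by rewrite ler_wpM2r// lerDl.
  by move: h1 h2; rewrite -(opprB x' x) edotNr; lra.
suff GF (x : 'rV[R]_n) (F : set_system 'rV[R]_n) : Filter F -> z @[z --> F] --> x ->
    supconv z @[z --> F] --> supconv x by move=> x; exact: (GF x (nbhs x) _ cvg_id).
move=> FF Fx; apply/cvgrPdist_le => e e0.
have := @cvgr_dist_le _ _ _ _ _ _ _ Fx (e / (n%:R * C + 1)).
move=> /(_ FF (divr_gt0 e0 D0)); apply: filterS => x' xx'.
have : (n%:R * C + 1) * `|x - x'| <= e by rewrite mulrC -ler_pdivlMr.
move=> h; apply: le_trans h; rewrite ler_norml half andbT lerNl opprB.
by rewrite distrC half.
Qed.

(** The affine function of slope y touches the sup-convolution from below. *)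
Lemma supconv_touching_slope x y p Z : supconv_argmax x y ->
  (\forall z \near (0 : 'rV[R]_n),
    supconv (x + z) <= supconv x + edot p z + 2^-1 * qform Z z) -> p = y.
Proof.
move=> xy touch; apply/esym/eqP; rewrite -subr_eq0; apply/eqP.
apply: (@linear_le_quadratic _ _ _ Z); apply: filterS touch => z.
have := supconv_subgradient xy (x + z); rewrite (addrAC x z) subrr add0r edotDl edotNl; lra.
Qed.

(** In the defining maximum, move x and y by the same vector z: the value at y + z
is bounded by the sup-convolution at x + z, and the remaining terms are
explicit. *)
Lemma supconv_jet x y p Z : supconv_argmax x y ->
  (\forall z \near (0 : 'rV[R]_n),
    supconv (x + z) <= supconv x + edot p z + 2^-1 * qform Z z) ->
  \forall z \near (0 : 'rV[R]_n), K (y + z) ->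
    w (y + z) <= w y + edot (y - x) z + 2^-1 * qform (Z - 1%:M) z.
Proof.
move=> xy touch; have py := supconv_touching_slope xy touch.
apply: filterS touch => z; rewrite py => h Kyz.
have [_ /(_ _ Kyz)] := YE (x + z); have [Kx /(_ y xy.1)] := YE x.
have := xy.2 _ Kx; move: h; rewrite /supconv /supconv_at.
rewrite qformBl qform_scalar !(edotDl, edotDr, edotNl).
rewrite (edotC z y); lra.
Qed.

End SupConvolution.

(** * Comparison at a fixed penalty *)

Section Sequences.
Context {U : set_system nat} {UU : UltraFilter U}.

Lemma cvg_within_seq {T V : topologicalType} (K : set T) (f : T -> V) (y_ : nat -> T) p :
  {within K, continuous f} -> (forall m, K (y_ m)) -> K p ->
  y_ @ U --> p -> f (y_ m) @[m --> U] --> f p.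
Proof.
have UF : ProperFilter U by exact: ultra_proper.
move=> /subspace_continuousP fK yK Kp yp A /(fK p Kp) KA.
have yA : U [set m | K (y_ m) -> A (f (y_ m))] := yp [set x | K x -> A (f x)] KA.
have sub : [set m | K (y_ m) -> A (f (y_ m))] `<=` [set m | A (f (y_ m))].
  by move=> m; apply; exact: yK.
exact: (@filterS _ U _ _ _ sub yA).
Qed.

Context {R : realType} {n : nat}.
Variables (K : set 'rV[R]_n) (w : 'rV[R]_n -> R) (Y : 'rV[R]_n -> 'rV[R]_n).
Hypotheses (Uoo : \oo `<=` U) (K_compact : compact K) (w_cont : {within K, continuous w}).
Hypothesis YE : forall x, supconv_argmax K w x (Y x).

(** Touching points x_ m tending to xh have maximisers y_ m in a compact set; any
limit of the latter is a maximiser at xh, by continuity. *)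
Lemma supconv_limit_jets xh X :
  (forall eps, 0 < eps -> exists x p, `|x - xh| <= eps /\ \forall z \near (0 : 'rV[R]_n),
     supconv w Y (x + z) <= supconv w Y x + edot p z + 2^-1 * qform (X + eps%:M) z) ->
  exists x_ y_ yh, [/\ x_ @ U --> xh, y_ @ U --> yh, supconv_argmax K w xh yh,
    forall m : nat, K (y_ m) &
    forall m, \forall z \near (0 : 'rV[R]_n), K (y_ m + z) ->
      w (y_ m + z) <= w (y_ m) + edot (y_ m - x_ m) z +
        2^-1 * qform (X + m.+1%:R^-1%:M - 1%:M) z].
Proof.
have UF : ProperFilter U by exact: ultra_proper.
move=> H.
have [x_ xP] := choice (fun m => H m.+1%:R^-1 ltac:(by rewrite invr_gt0 ltr0n)).
have xxh : x_ @ U --> xh.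
  apply/cvgrPdist_le => e e0.
  have := near_infty_natSinv_lt (PosNum e0) => /Uoo; apply: filterS => m /= me.
  have [p [xm _]] := xP m; rewrite distrC (le_trans xm)// ltW//.
pose y_ m := Y (x_ m).
have yK m : K (y_ m) by have [] := YE (x_ m).
have [yh Kyh yyh] := ultra_compact_cvg (f := y_) K_compact (filterE _ yK).
exists x_, y_, yh; split => //.
- split=> // y' Ky'.
  have lhs : supconv_at w (x_ m) y' @[m --> U] --> supconv_at w xh y'.
    by apply: (cvg_supconv_at (f := fun=> y')) => //; exact: cvg_cst.
  have rhs : supconv_at w (x_ m) (y_ m) @[m --> U] --> supconv_at w xh yh.
    by apply: cvg_supconv_at => //; exact: cvg_within_seq.
  apply: (ler_cvg_to lhs rhs); apply: filterE => m.
  by have [_] := YE (x_ m); exact.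
- move=> m; have [p [_ touch]] := xP m.
  exact: supconv_jet (YE (x_ m)) touch.
Qed.

End Sequences.

Section Jets.
Context {R : realType} {n : nat}.
Variables (Omega K : set 'rV[R]_n).
Hypothesis OK : Omega `<=` K.

Lemma zero_littleo : (fun _ : 'rV[R]_n => 0 : R) =o_ (0 : 'rV[R]_n) (fun z => edot z z).
Proof.
apply/eqoP => e e0; apply: filterE => z.
by rewrite normr0 mulr_ge0// ltW.
Qed.

Lemma superjet_scaled (u : 'rV[R]_n -> R) delta x p X : 0 < delta -> symmx n X ->
  (\forall z \near (0 : 'rV[R]_n), K (x + z) ->
     delta * u (x + z) <= delta * u x + edot p z + 2^-1 * qform X z) ->
  superjet Omega u x (delta^-1 *: p, delta^-1 *: X).
Proof.
move=> d0 Xs h; split; first by rewrite /symmx /= linearZ /= Xs.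
exists (fun=> 0); first exact: zero_littleo.
apply: filterS h => z h /OK/h {}h.
rewrite edotZl qformZl addr0 -(ler_pM2l d0); apply: (le_trans h).
by rewrite le_eqVlt; apply/orP; left; apply/eqP; field; rewrite gt_eqF.
Qed.

Lemma subjet_scaled (v : 'rV[R]_n -> R) delta x p X : 0 < delta -> symmx n X ->
  (\forall z \near (0 : 'rV[R]_n), K (x + z) ->
     - (delta * v (x + z)) <= - (delta * v x) + edot p z + 2^-1 * qform X z) ->
  subjet Omega v x (- delta^-1 *: p, - delta^-1 *: X).
Proof.
move=> d0 Xs h; split; first by rewrite /symmx /= linearZ /= Xs.
exists (fun=> 0); first exact: zero_littleo.
apply: filterS h => z h /OK/h {}h.
rewrite edotZl qformZl addr0 -(ler_pM2l d0) -lerN2; apply: (le_trans h).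
by rewrite le_eqVlt; apply/orP; left; apply/eqP; field; rewrite gt_eqF.
Qed.

End Jets.

Section Comparison.
Context {R : realType} {n : nat}.
Variables (Omega : set 'rV[R]_n) (F : R -> 'rV[R]_n -> 'M[R]_n -> R).
Variables (f u v : 'rV[R]_n -> R) (gamma : R).
Hypotheses (Omega_open : open Omega) (Omega_bounded : bounded_set Omega).
Hypothesis F_cont : {within [set t : R * 'rV[R]_n * 'M[R]_n | symmx n t.2],
  continuous (fun t => F t.1.1 t.1.2 t.2)}.
Hypothesis f_cont : {within closure Omega, continuous f}.
Hypothesis F_elliptic : forall (r : R) (p : 'rV[R]_n) (X Y : 'M[R]_n),
  symmx n X -> symmx n Y -> loewner_le X Y -> F r p X <= F r p Y.
Hypothesis F_proper : forall (r s : R) (p : 'rV[R]_n) (X : 'M[R]_n),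
  symmx n X -> r <= s -> F r p X >= F s p X + gamma * (s - r).
Hypotheses (u_cont : {within closure Omega, continuous u})
  (v_cont : {within closure Omega, continuous v}).
Hypotheses (u_sol : viscosity_ge Omega F f u) (v_sol : viscosity_le Omega F f v).

Let K := closure Omega.

Lemma closure_compact : compact K.
Proof.
apply: bounded_closed_compact; last exact: closed_closure.
have [M [Mr MO]] := Omega_bounded; exists M; split=> // r Mr' x.
have cl : closed [set y : 'rV[R]_n | `|y| <= r].
  rewrite (_ : [set y | _] = Num.norm @^-1` [set s | s <= r])//.
  by apply: closed_comp (@closed_le _ _) => y _; exact: norm_continuous.
by move=> /(closureS (MO r Mr')); rewrite -((closure_id _).1 cl).
Qed.

Lemma F_cvg {U : set_system nat} {UU : UltraFilter U} (r_ : nat -> R) p_ X_ r p X :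
  (forall m, symmx n (X_ m)) -> symmx n X -> r_ @ U --> r -> p_ @ U --> p -> X_ @ U --> X ->
  F (r_ m) (p_ m) (X_ m) @[m --> U] --> F r p X.
Proof.
have UF : ProperFilter U by exact: ultra_proper.
move=> Xs_ Xs rr pp XX.
apply: (cvg_within_seq (y_ := fun m => (r_ m, p_ m, X_ m)) (p := (r, p, X)) F_cont) => //.
have rp : (r_ m, p_ m) @[m --> U] --> (r, p) by exact: (cvg_pair rr pp).
exact: (cvg_pair rp XX).
Qed.

(** The comparison argument at a fixed penalty. The pair (y, z) maximises
delta (u(y) - v(z)) - |y - z|^2/4; this is the maximum of a + b - |x|^2, because
the best x for given y and z is their midpoint. *)
Lemma penalized_comparison delta : 0 < delta -> K !=set0 -> exists y z, [/\ K y, K z,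
  forall x, K x -> delta * (u x - v x) <= delta * (u y - v z) - 4^-1 * edot (y - z) (y - z) &
  Omega y -> Omega z -> v z <= u y -> gamma * (u y - v z) <= f z - f y].
Proof.
move=> d0 K0; have cK := closure_compact.
pose wu x := delta * u x; pose wv x := - (delta * v x).
have wu_cont : {within K, continuous wu}.
  apply/subspace_continuousP => x Kx; apply: cvgM; first exact: cvg_cst.
  by have /subspace_continuousP := u_cont; exact.
have wv_cont : {within K, continuous wv}.
  apply/subspace_continuousP => x Kx; apply: cvgN; apply: cvgM; first exact: cvg_cst.
  by have /subspace_continuousP := v_cont; exact.
have [Yu YuP] := choice (fun x => supconv_argmax_exists cK wu_cont x K0).
have [Yv YvP] := choice (fun x => supconv_argmax_exists cK wv_cont x K0).
pose a := supconv wu Yu; pose b := supconv wv Yv.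
have ca : continuous a := supconv_continuous cK YuP.
have cb : continuous b := supconv_continuous cK YvP.
have sa : has_subgradients a := supconv_has_subgradients YuP.
have sb : has_subgradients b := supconv_has_subgradients YvP.
pose phi x := a x + b x - edot x x.
have cphi : continuous phi.
  suff GF (x : 'rV[R]_n) (G : set_system 'rV[R]_n) : Filter G -> t @[t --> G] --> x ->
      phi t @[t --> G] --> phi x by move=> x; exact: (GF x (nbhs x) _ cvg_id).
  move=> FG Gx; apply: cvgB; last exact: cvg_edot.
  by apply: cvgD; [exact: (continuous_cvg _ (ca _) Gx)|exact: (continuous_cvg _ (cb _) Gx)].
(* Replacing x by the midpoint of its two maximisers does not decrease phi. *)
have phi_mid x : phi x <= phi (2^-1 *: (Yu x + Yv x)).
  have [Kux _] := YuP x; have [Kvx _] := YvP x.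
  set mid := 2^-1 *: _.
  have := (YuP mid).2 _ Kux; have := (YvP mid).2 _ Kvx; have := edot_ge0 (x - mid).
  rewrite /phi /a /b /supconv /supconv_at.
  rewrite !(edotDl, edotDr, edotNl, edotNr) (edotC mid x).
  have -> : edot x mid = 2^-1 * (edot x (Yu x) + edot x (Yv x)).
    by rewrite /mid edotZr edotDr.
  have midmid : edot mid mid = 2^-1 * (edot mid (Yu x) + edot mid (Yv x)).
    by rewrite {2}/mid edotZr edotDr.
  lra.
have [C C0 KC] := compact_coord_bound cK.
have [xh xh_max] : exists xh, forall x, phi x <= phi xh.
  have B0 : [set t : 'rV[R]_n | forall i, `|t 0 i| <= C] !=set0.
    by case: K0 => x /KC Kx; exists x.
  have [xh _ hmax] := compact_EVT_max B0 (@compact_cube _ _ _) (continuous_subspaceT cphi).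
  exists xh => x; apply: (le_trans (phi_mid x)); apply: hmax; apply: mem_set => i.
  have [/KC/(_ i) + _] := YuP x; have [/KC/(_ i) + _] := YvP x.
  by rewrite !mxE !ler_norml; lra.
have ab_le x : a x + b x <= edot x x + phi xh by have := xh_max x; rewrite /phi; lra.
have ab_eq : a xh + b xh = edot xh xh + phi xh by rewrite /phi; lra.
have [X [Y [Xs Ys XY jets]]] := convex_sums_jets ca cb sa sb ab_le ab_eq.
have [U [UU Uoo]] := @ultraFilterLemma nat \oo _.
have UF : ProperFilter U by exact: ultra_proper.
have [x_ [y_ [y [xx yy ymax yK yjet]]]] :=
  supconv_limit_jets Uoo cK wu_cont YuP (fun e e0 => (jets e e0).1).
have [x'_ [z_ [z [xx' zz zmax zK zjet]]]] :=
  supconv_limit_jets Uoo cK wv_cont YvP (fun e e0 => (jets e e0).2).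
have yz : y + z = 2 *: xh.
  apply/eqP; rewrite -subr_eq0; apply/eqP.
  apply: (@linear_le_quadratic _ _ _ 2%:M); apply: filterE => t.
  have := supconv_subgradient YuP ymax (xh + t); have := supconv_subgradient YvP zmax (xh + t).
  have := ab_le (xh + t); move: ab_eq; rewrite -/a -/b (addrAC xh t) subrr add0r qform_scalar.
  rewrite !(edotDl, edotDr, edotNl, edotNr, edotZl) (edotC t xh); lra.
have xhE : xh = 2^-1 *: (y + z) by rewrite yz scalerA mulVf ?scale1r.
exists y, z; split; [by case: ymax|by case: zmax| |].
  move=> x Kx; have := xh_max x; have := (YuP x).2 _ Kx; have := (YvP x).2 _ Kx.
  have := ymax.2 _ (YuP xh).1; have := zmax.2 _ (YvP xh).1.
  have xh_dot t : edot xh t = 2^-1 * (edot y t + edot z t) by rewrite xhE edotZl edotDl.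
  have := xh_dot y; have := xh_dot z; have := xh_dot xh.
  rewrite (edotC y xh) (edotC z xh) (edotC z y) !(edotDl, edotDr, edotNl, edotNr) (edotC z y).
  rewrite /phi /a /b /supconv /supconv_at /wu /wv; lra.
move=> Oy Oz vu.
have harm : m.+1%:R^-1 @[m --> U] --> (0 : R).
  by apply: cvg_trans (@cvg_harmonic R) => S; exact: Uoo.
have symA (A : 'M[R]_n) m : symmx n A -> symmx n (A + m.+1%:R^-1%:M - 1%:M).
  by move=> As; rewrite /symmx /= !linearD /= linearN /= !tr_scalar_mx As.
have matcvg (A : 'M[R]_n) : A + m.+1%:R^-1%:M - 1%:M @[m --> U] --> A - 1%:M.
  have -> : A - 1%:M = A + 0 *: 1%:M - 1%:M by rewrite scale0r addr0.
  apply: cvgB; last exact: cvg_cst.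
  apply: cvgD; first exact: cvg_cst.
  under eq_fun do rewrite -scalemx1.
  by apply: cvgZ; [exact: harm|exact: cvg_cst].
pose X' := delta^-1 *: (X - 1%:M); pose Y' := - delta^-1 *: (Y - 1%:M).
pose p := delta^-1 *: (y - xh).
have symB (A : 'M[R]_n) c : symmx n A -> symmx n (c *: A).
  by move=> As; rewrite /symmx /= linearZ /= As.
have symC (A : 'M[R]_n) : symmx n A -> symmx n (A - 1%:M).
  by move=> As; rewrite /symmx /= linearD /= linearN /= tr_scalar_mx As.
have OK : Omega `<=` K by exact: subset_closure.
have near_Omega (q_ : nat -> 'rV[R]_n) q : q_ @ U --> q -> Omega q ->
    \forall m \near U, Omega (q_ m).
  by move=> qq Oq; apply: qq; exact: open_nbhs_nbhs.
have fy : f y <= F (u y) p X'.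
  have fl : f (y_ m) @[m --> U] --> f y by apply: cvg_within_seq => //; exact: ymax.1.
  have Fl : F (u (y_ m)) (delta^-1 *: (y_ m - x_ m))
      (delta^-1 *: (X + m.+1%:R^-1%:M - 1%:M)) @[m --> U] --> F (u y) p X'.
    apply: F_cvg.
    - by move=> m; apply/symB/symA.
    - exact/symB/symC.
    - by apply: cvg_within_seq => //; exact: ymax.1.
    - by apply: cvgZ; [exact: cvg_cst|exact: cvgB].
    - by apply: cvgZ; [exact: cvg_cst|exact: matcvg].
  apply: (ler_cvg_to fl Fl); apply: filterS (near_Omega _ _ yy Oy) => m Oym.
  by apply: u_sol => //; apply: superjet_scaled (yjet m) => //; exact: symA.
have fz : F (v z) p Y' <= f z.
  have -> : p = - delta^-1 *: (z - xh).
    rewrite /p scaleNr -scalerN opprB; congr (_ *: _).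
    by apply/rowP => i; have /rowP/(_ i) := yz; rewrite !mxE; lra.
  have fl : f (z_ m) @[m --> U] --> f z by apply: cvg_within_seq => //; exact: zmax.1.
  have Fl : F (v (z_ m)) (- delta^-1 *: (z_ m - x'_ m))
      (- delta^-1 *: (Y + m.+1%:R^-1%:M - 1%:M)) @[m --> U] -->
      F (v z) (- delta^-1 *: (z - xh)) Y'.
    apply: F_cvg.
    - by move=> m; apply/symB/symA.
    - exact/symB/symC.
    - by apply: cvg_within_seq => //; exact: zmax.1.
    - by apply: cvgZ; [exact: cvg_cst|exact: cvgB].
    - by apply: cvgZ; [exact: cvg_cst|exact: matcvg].
  apply: (ler_cvg_to Fl fl); apply: filterS (near_Omega _ _ zz Oz) => m Ozm.
  by apply: v_sol => //; apply: subjet_scaled (zjet m) => //; exact: symA.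
have X'Y' : loewner_le X' Y'.
  move=> t; have := XY t; rewrite qformBl !qformZl !qformBl !qform_scalar => h.
  rewrite (_ : _ - _ = delta^-1 * (2 * edot t t - (qform X t + qform Y t))); last by ring.
  by rewrite mulr_ge0 ?subr_ge0// invr_ge0 ltW.
have := F_elliptic (u y) p (symB _ _ (symC _ Xs)) (symB _ _ (symC _ Ys)) X'Y'.
have := F_proper p (symB _ (- delta^-1) (symC _ Ys)) vu.
rewrite -/X' -/Y'; lra.
Qed.

End Comparison.

(** * The comparison principle *)

Theorem theorem1 (R : realType) (n : nat) (Omega : set 'rV[R]_n)
  (F : R -> 'rV[R]_n -> 'M[R]_n -> R) (f u v : 'rV[R]_n -> R) (gamma : R)
  (Omega_open : open Omega)
  (Omega_bounded : bounded_set Omega)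
  (F_cont : {within [set t : R * 'rV[R]_n * 'M[R]_n | symmx n t.2],
               continuous (fun t => F t.1.1 t.1.2 t.2)})
  (f_cont : {within closure Omega, continuous f})
  (F_elliptic : forall (r : R) (p : 'rV[R]_n) (X Y : 'M[R]_n),
     symmx n X -> symmx n Y -> loewner_le X Y -> F r p X <= F r p Y)
  (gamma_gt0 : 0 < gamma)
  (F_proper : forall (r s : R) (p : 'rV[R]_n) (X : 'M[R]_n),
     symmx n X -> r <= s -> F r p X >= F s p X + gamma * (s - r))
  (u_cont : {within closure Omega, continuous u})
  (v_cont : {within closure Omega, continuous v})
  (u_sol : viscosity_ge Omega F f u)
  (v_sol : viscosity_le Omega F f v) :
  (forall x, (closure Omega `\` interior Omega) x -> u x <= v x) ->
  forall x, closure Omega x -> u x <= v x.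
Proof.
move=> boundary x0 Kx0; rewrite leNgt; apply/negP => vu0.
pose theta := u x0 - v x0.
have theta0 : 0 < theta by rewrite subr_gt0.
have K0 : closure Omega !=set0 by exists x0.
have delta0 m : 0 < m.+1%:R^-1 :> R by rewrite invr_gt0 ltr0n.
have [y_ yP] := choice (fun m => penalized_comparison Omega_open Omega_bounded F_cont
  f_cont F_elliptic F_proper u_cont v_cont u_sol v_sol (delta0 m) K0).
have [z_ yzP] := choice yP.
have gap m : 4^-1 * edot (y_ m - z_ m) (y_ m - z_ m) <=
    m.+1%:R^-1 * (u (y_ m) - v (z_ m) - theta).
  have [_ _ /(_ x0 Kx0) + _] := yzP m.
  by rewrite -/theta [in X in _ -> X]mulrBr !lerBrDr [in X in X -> _]addrC.
have uv m : theta <= u (y_ m) - v (z_ m).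
  by rewrite -subr_ge0 -(pmulr_rge0 _ (delta0 m)) (le_trans _ (gap m))// mulr_ge0// edot_ge0.
have [U [UU Uoo]] := @ultraFilterLemma nat \oo _.
have UF : ProperFilter U by exact: ultra_proper.
have cK := closure_compact Omega_bounded.
have yK m : closure Omega (y_ m) by have [] := yzP m.
have zK m : closure Omega (z_ m) by have [] := yzP m.
have [y Ky yy] := ultra_compact_cvg (U := U) (f := y_) cK (filterE _ yK).
have [z Kz zz] := ultra_compact_cvg (U := U) (f := z_) cK (filterE _ zK).
have cvgK (w : 'rV[R]_n -> R) q_ q : {within closure Omega, continuous w} ->
    (forall m, closure Omega (q_ m)) -> closure Omega q -> q_ @ U --> q ->
    w (q_ m) @[m --> U] --> w q by exact: cvg_within_seq.
have uyvz : u (y_ m) - v (z_ m) @[m --> U] --> u y - v z.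
  by apply: cvgB; exact: cvgK.
have harm : m.+1%:R^-1 @[m --> U] --> (0 : R).
  by apply: cvg_trans (@cvg_harmonic R) => S; exact: Uoo.
have yz : y = z.
  apply/eqP; rewrite -subr_eq0; apply/eqP/edot_eq0/eqP; rewrite eq_le edot_ge0 andbT.
  have lhs : 4^-1 * edot (y_ m - z_ m) (y_ m - z_ m) @[m --> U] -->
      4^-1 * edot (y - z) (y - z).
    by apply: cvgM; [exact: cvg_cst|apply: cvg_edot; exact: cvgB].
  have rhs : m.+1%:R^-1 * (u (y_ m) - v (z_ m) - theta) @[m --> U] -->
      0 * (u y - v z - theta).
    by apply: cvgM => //; apply: cvgB => //; exact: cvg_cst.
  have : 4^-1 * edot (y - z) (y - z) <= 0 * (u y - v z - theta).
    by apply: (ler_cvg_to lhs rhs); exact: filterE.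
  by rewrite mul0r pmulr_rle0.
have uvy : theta <= u y - v y.
  by rewrite {2}yz; apply: (cvgr_to_ge uyvz); exact: filterE.
have Oy : Omega y.
  apply: contrapT => nOy; have : u y <= v y.
    by apply: boundary; split => //; apply: contra_not nOy; exact: interior_subset.
  lra.
have Oz : Omega z by rewrite -yz.
have near_Omega q_ (q : 'rV[R]_n) : q_ @ U --> q -> Omega q -> \forall m \near U, Omega (q_ m).
  by move=> qq Oq; apply: qq; exact: open_nbhs_nbhs.
have fzy : f (z_ m) - f (y_ m) @[m --> U] --> f z - f y.
  by apply: cvgB; exact: cvgK.
have : gamma * theta <= f z - f y.
  apply: (cvgr_to_ge fzy); apply: filterS2 (near_Omega _ _ yy Oy) (near_Omega _ _ zz Oz).
  move=> m Oym Ozm; have [_ _ _ /(_ Oym Ozm) h] := yzP m; have uvm := uv m.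
  by apply: le_trans (h _); [rewrite ler_pM2l|lra].
by rewrite yz subrr; apply/negP; rewrite -ltNge mulr_gt0.
Qed.
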